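(* The pair $(K_3,C_4^{\triangle})$ is forcing. That is, for every $p\in(0,1]$ and $\varepsilon>0$ there is some $\delta>0$ such that every graph $G$ satisfying \[ t(K_3,G)\ge(1-\delta)p^{3}\quad\text{and}\quad t(C_4^{\triangle},G)\le(1+\delta)p^{12} \] is $(\varepsilon,p)$-quasirandom.
   Context: Graphs are finite, simple and undirected, with nonempty vertex set. For graphs $F$ and $G$, $\hom(F,G)$ is the number of graph homomorphisms from $F$ to $G$, and $t(F,G)=\hom(F,G)/|V(G)|^{|V(F)|}$ is the homomorphism density. $K_3$ is the triangle. For a graph $F$, the graph $F^{\triangle}$ is obtained from $F$ by replacing every edge by a triangle, each of which introduces a new vertex: for every edge $uv\in E(F)$ one adds a new vertex $w_{uv}$ (distinct for distinct edges) together with the edges $uw_{uv}$ and $vw_{uv}$, keeping the edge $uv$. Thus $C_4^{\triangle}$, obtained from the 4-cycle $C_4$, has 8 vertices and 12 edges. For $X,Y\subseteq V$, $e_G(X,Y)$ is the number of ordered pairs $(x,y)\in X\times Y$ with $xy\in E$ (so edges contained in $X\cap Y$ are counted twice). For $\varepsilon>0$ and $p\in(0,1]$, a graph $G=(V,E)$ is called $(\varepsilon,p)$-quasirandom if for all $X,Y\subseteq V$ we have $\bigl|e_G(X,Y)-p|X||Y|\bigr|\le\varepsilon|V|^2$. A pair of graphs $(F_1,F_2)$ is forcing if for every $p\in(0,1]$ and $\varepsilon>0$ there is some $\delta>0$ such that every graph $G$ with $t(F_1,G)\ge(1-\delta)p^{e(F_1)}$ and $t(F_2,G)\le(1+\delta)p^{e(F_2)}$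 is $(\varepsilon,p)$-quasirandom, where $e(F_i)$ is the number of edges of $F_i$. *)

(* Defs.v *)
From mathcomp Require Import all_boot all_order all_algebra.
From mathcomp Require Import reals.

Set Implicit Arguments.
Unset Strict Implicit.
Unset Printing Implicit Defensive.

Import Order.TTheory GRing.Theory Num.Theory.
Local Open Scope ring_scope.

Record sgraph := SGraph {
  vertex :> finType;
  adj : rel vertex;
  adj_sym : symmetric adj;
  adj_irr : irreflexive adj;
  vertex_gt0 : (0 < #|vertex|)%N
}.

Definition edges (G : sgraph) : {set {set G}} :=
  [set [set x; y] | x in [set: G], y in [set: G] & adj x y].

Definition hom_set (F G : sgraph) : {set {ffun F -> G}} :=
  [set f : {ffun F -> G} | [forall x, forall y, adj x y ==> adj (f x) (f y)]].

Definition hom (F G : sgraph) : nat := #|hom_set F G|.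

Definition hom_density (R : realType) (F G : sgraph) : R :=
  (hom F G)%:R / (#|G| ^ #|F|)%:R.

(* Ordered pairs: an edge inside X :&: Y counts twice. *)
Definition edge_count (G : sgraph) (X Y : {set G}) : nat :=
  #|[set xy in setX X Y | adj xy.1 xy.2]|.

Definition quasirandom (R : realType) (eps p : R) (G : sgraph) : Prop :=
  forall X Y : {set G},
    `|(edge_count X Y)%:R - p * #|X|%:R * #|Y|%:R| <= eps * #|G|%:R ^+ 2.

Definition forcing (R : realType) (F1 F2 : sgraph) : Prop :=
  forall p eps : R, 0 < p -> p <= 1 -> 0 < eps ->
  exists2 delta : R, 0 < delta &
    forall G : sgraph,
      (1 - delta) * p ^+ #|edges F1| <= hom_density R F1 G ->
      hom_density R F2 G <= (1 + delta) * p ^+ #|edges F2| ->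
      quasirandom eps p G.

Section Triangles.
Variable F : sgraph.

(* The new vertex attached to an edge e of F is inr e. *)
Definition tri_vertex : finType := (F + {e : {set F} | e \in edges F})%type.

Definition tri_adj : rel tri_vertex := fun a b =>
  match a, b with
  | inl x, inl y => adj x y
  | inl x, inr e => x \in val e
  | inr e, inl x => x \in val e
  | inr _, inr _ => false
  end.

Lemma tri_adj_sym : symmetric tri_adj.
Proof. by move=> [x|e] [y|f] //=; rewrite adj_sym. Qed.

Lemma tri_adj_irr : irreflexive tri_adj.
Proof. by move=> [x|e] //=; rewrite adj_irr. Qed.

Lemma tri_vertex_gt0 : (0 < #|tri_vertex|)%N.
Proof. by rewrite card_sum addn_gt0 vertex_gt0. Qed.

Definition triangulate : sgraph :=
  SGraph tri_adj_sym tri_adj_irr tri_vertex_gt0.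

End Triangles.

Definition K3_adj : rel 'I_3 := fun i j => i != j.

Lemma K3_adj_sym : symmetric K3_adj.
Proof. by move=> i j; rewrite /K3_adj eq_sym. Qed.

Lemma K3_adj_irr : irreflexive K3_adj.
Proof. by move=> i; rewrite /K3_adj eqxx. Qed.

Lemma K3_vertex_gt0 : (0 < #|'I_3|)%N.
Proof. by rewrite card_ord. Qed.

Definition K3 : sgraph := SGraph K3_adj_sym K3_adj_irr K3_vertex_gt0.

(* ordS is the cyclic successor. *)
Definition C4_adj : rel 'I_4 := fun i j => (ordS i == j) || (ordS j == i).

Lemma C4_adj_sym : symmetric C4_adj.
Proof. by move=> i j; rewrite /C4_adj orbC. Qed.

Lemma C4_adj_irr : irreflexive C4_adj.
Proof. by case=> [[|[|[|[|]]]]]. Qed.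

Lemma C4_vertex_gt0 : (0 < #|'I_4|)%N.
Proof. by rewrite card_ord. Qed.

Definition C4 : sgraph := SGraph C4_adj_sym C4_adj_irr C4_vertex_gt0.

Local Close Scope ring_scope.

Lemma edgesP (G : sgraph) (e : {set G}) :
  reflect (exists x y, adj x y /\ e = [set x; y]) (e \in edges G).
Proof.
apply: (iffP imset2P) => [[x y _]|[x [y [a ->]]]].
  by rewrite !inE /= => a ->; exists x, y.
by exists x y => //; rewrite !inE.
Qed.

Lemma card_edge (G : sgraph) (e : {set G}) : e \in edges G -> #|e| = 2.
Proof.
move/edgesP=> [x [y [a ->]]]; rewrite cards2.
by case: eqP a => // ->; rewrite adj_irr.
Qed.

Lemma card_edges_triangulate (F : sgraph) : #|edges (triangulate F)| = 3 * #|edges F|.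
Proof.
pose T := triangulate F.
pose E : finType := {e : {set F} | e \in edges F}.
pose A := (fun e : {set F} => (@inl F E : F -> T) @: e) @: edges F.
pose P := [set u : F * E | u.1 \in val u.2].
pose g (u : F * E) : {set T} := [set (inl u.1 : T); (inr u.2 : T)].
have -> : edges T = A :|: g @: P.
  apply/setP=> s; rewrite inE; apply/edgesP/orP.
    case=> -[x|e] [[y|f] [/= a ->]] //.
    - left; apply/imsetP; exists [set x; y]; first by apply/edgesP; exists x, y.
      by rewrite imsetU1 imset_set1.
    - by right; apply/imsetP; exists (x, f); rewrite ?inE.
    - by right; apply/imsetP; exists (y, e); rewrite ?inE // /g setUC.
  case=> /imsetP.
    case=> e /edgesP[x [y [a ->]]] ->; exists (inl x), (inl y); split=> //.
    by rewrite imsetU1 imset_set1.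
  by case=> -[x e]; rewrite inE /= => xe ->; exists (inl x), (inr e).
have dis : A :&: g @: P = set0.
  apply/setP=> s; rewrite !inE; apply/negP=> /andP[/imsetP[e _ ->] /imsetP[[x f] _ h]].
  have : (inr f : T) \in [set inl x; inr f] by rewrite !inE eqxx orbT.
  by rewrite /g /= in h; rewrite -h => /imsetP[].
rewrite cardsU dis cards0 subn0 card_imset; last by apply: imset_inj => ? ? [].
rewrite card_imset; last first.
  move=> [x e] [y f] /setP h.
  have := h (inl x); have := h (inr e); rewrite !inE /= !eqxx /=.
  by move=> /esym/eqP[->] /esym; rewrite orbF => /eqP[->].
rewrite mulSn; congr addn.
have -> : #|P| = \sum_(e : E) #|val e|.
  rewrite -sum1_card (eq_bigl (fun u : F * E => u.1 \in val u.2)); last by move=> u; rewrite inE.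
  rewrite -(pair_big_dep xpredT (fun x (e : E) => x \in val e) (fun _ _ => 1)) /=.
  rewrite (exchange_big_dep xpredT) //=; apply: eq_bigr => e _; by rewrite sum1_card.
rewrite (eq_bigr (fun _ => 2)); last by move=> e _; apply: card_edge (valP e).
by rewrite sum_nat_const card_sig mulnC.
Qed.

Lemma card_edges_C4 : #|edges C4| = 4.
Proof.
have -> : edges C4 = (fun i : 'I_4 => [set i; ordS i]) @: [set: 'I_4].
  apply/setP=> s; apply/edgesP/imsetP.
    case=> i [j [/orP[/eqP<-|/eqP<-] ->]]; [by exists i|exists j => //; by rewrite setUC].
  case=> i _ ->; exists i, (ordS i); split=> //; by rewrite /= /C4_adj eqxx.
rewrite card_imset ?cardsT ?card_ord // => i j /setP h.
have := h i; have := h (ordS i); rewrite !inE !eqxx ?orbT /= => a b; move: a b; clear.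
by case: i j => [[|[|[|[|]]]] //= ?] [[|[|[|[|]]]] //= ?] // _ _; apply: val_inj.
Qed.

Lemma card_edges_K3 : #|edges K3| = 3.
Proof.
have -> : edges K3 = (fun i : 'I_3 => [set~ i]) @: [set: 'I_3].
  apply/setP=> s; apply/edgesP/imsetP.
    case=> i [j [a ->]].
    have ht: (3 - i - j < 3)%N by move: a; case: i j => [[|[|[|]]] //= ?] [[|[|[|]]] //= ?].
    exists (Ordinal ht) => //; apply/setP=> k; rewrite !inE.
    by move: k a ht; case: i j => [[|[|[|]]] //= ?] [[|[|[|]]] //= ?] [[|[|[|]]] //= ?].
  case=> i _ ->; exists (ordS i), (ordS (ordS i)); split.
    by case: i => [[|[|[|]]] //= ?].
  by apply/setP=> k; rewrite !inE; case: i k => [[|[|[|]]] //= ?] [[|[|[|]]] //= ?].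
rewrite card_imset ?cardsT ?card_ord // => i j /setP h.
by have := h i; rewrite !inE eqxx /= => /esym/negbFE/eqP.
Qed.

Lemma card_triangulate_C4 : #|triangulate C4| = 8.
Proof. by rewrite card_sum card_sig card_edges_C4 card_ord. Qed.
Lemma card_edges_triangulate_C4 : #|edges (triangulate C4)| = 12.
Proof. by rewrite card_edges_triangulate card_edges_C4. Qed.

(* Main.v *)
(* Let A be the adjacency matrix of G, D its normalised codegree matrix and
   q = p^3.  The hypotheses say that the weighted graph B = A D has edge density
   almost q and 4-cycle density almost q^4, so B is q-quasirandom.  As D is an
   average of rectangles, cut-norm closeness of A D and q survives multiplication
   by polynomials in D; approximating 1/D by such polynomials shows that A is
   close in cut norm to the kernel W = q/D, and then that W(x,y) W^2(x,y) = q
   approximately, W^2 being the operator square.  In the exact equation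
   the cross ratios W(x,y) W(u,v) / (W(x,v) W(u,y)) and those of W^2 are inverse
   to each other, while composition with a positive kernel contracts cross
   ratios: a bound K > 1 improves to (K^2 + 1) / (2 K) < K.  Iterating, all cross
   ratios are close to 1, which forces W to be close to the constant p. *)
Require Import Defs.
From mathcomp Require Import all_boot all_order all_algebra.
From mathcomp Require Import reals.
From mathcomp Require Import ring lra.

Set Implicit Arguments.
Unset Strict Implicit.
Unset Printing Implicit Defensive.

Import Order.TTheory GRing.Theory Num.Theory.
Local Open Scope ring_scope.

(** * Averages over a finite type *)

Definition avg (R : realFieldType) (T : finType) (f : T -> R) : R :=
  (\sum_x f x) / #|T|%:R.

Reserved Notation "\avg_ x F" (at level 41, x name, F at level 41,
  right associativity, format "'[' \avg_ x '/  '  F ']'").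
Notation "\avg_ x F" := (avg (fun x => F)) : ring_scope.

Section Average.
Variables (R : realFieldType) (T : finType).
Implicit Types (f g : T -> R) (c : R).

Lemma eq_avg f g : f =1 g -> avg f = avg g.
Proof. by move=> fg; rewrite /avg (eq_bigr _ (fun x _ => fg x)). Qed.

Lemma avgD f g : \avg_ x (f x + g x) = avg f + avg g.
Proof. by rewrite /avg big_split mulrDl. Qed.

Lemma avgN f : \avg_ x (- f x) = - avg f.
Proof. by rewrite /avg sumrN mulNr. Qed.

Lemma avgB f g : \avg_ x (f x - g x) = avg f - avg g.
Proof. by rewrite avgD avgN. Qed.

Lemma avgZ c f : \avg_ x (c * f x) = c * avg f.
Proof. by rewrite /avg -mulr_sumr mulrA. Qed.

Lemma avgZr c f : \avg_ x (f x * c) = avg f * c.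
Proof. by rewrite /avg -mulr_suml mulrAC. Qed.

Lemma ler_avg f g : (forall x, f x <= g x) -> avg f <= avg g.
Proof. by move=> fg; rewrite /avg; apply: ler_wpM2r; rewrite ?invr_ge0 ?ler0n // ler_sum. Qed.

Lemma avg_ge0 f : (forall x, 0 <= f x) -> 0 <= avg f.
Proof. by move=> f0; rewrite /avg divr_ge0 ?ler0n // sumr_ge0. Qed.

Lemma ler_norm_avg f : `|avg f| <= \avg_ x `|f x|.
Proof.
rewrite /avg normrM normfV normr_nat.
by apply: ler_wpM2r; rewrite ?invr_ge0 ?ler0n // ler_norm_sum.
Qed.

Lemma exchange_avg (S : finType) (F : T -> S -> R) :
  \avg_ x \avg_ y F x y = \avg_ y \avg_ x F x y.
Proof.
rewrite /avg -!mulr_suml exchange_big /= -!mulrA; congr (_ * _).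
by rewrite mulrC.
Qed.

Hypothesis T_gt0 : (0 < #|T|)%N.

Lemma avg_cst c : avg (fun _ : T => c) = c.
Proof.
rewrite /avg sumr_const -[c *+ _]mulr_natr mulfK // pnatr_eq0.
by rewrite -lt0n.
Qed.

Lemma avg_le c f : (forall x, f x <= c) -> avg f <= c.
Proof. by move=> fc; rewrite -[leRHS]avg_cst ler_avg. Qed.

(** Nonnegativity of the variance; this is the form in which Cauchy-Schwarz is applied below. *)
Lemma sqr_avg_le f : avg f ^+ 2 <= \avg_ x (f x ^+ 2).
Proof.
have : 0 <= \avg_ x ((f x - avg f) ^+ 2) by apply: avg_ge0 => x; exact: sqr_ge0.
rewrite (@eq_avg _ (fun x => f x ^+ 2 - (2 * avg f * f x - avg f ^+ 2))); last first.
  by move=> x; ring.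
by rewrite avgB avgB avgZ avg_cst => h; nra.
Qed.

End Average.

Section ProductAverage.
Variables (R : realFieldType) (S T : finType).

Lemma avg_pair (F : S -> T -> R) :
  avg (fun p : S * T => F p.1 p.2) = \avg_ x \avg_ y F x y.
Proof.
rewrite /avg -(pair_big predT predT F) /= card_prod natrM invfM mulrA.
by rewrite !mulr_suml; apply: eq_bigr => x _; rewrite -!mulrA; congr (_ * _); exact: mulrC.
Qed.

End ProductAverage.

Section QuadrupleAverage.
Variables (R : realFieldType) (T : finType).
Hypothesis T_gt0 : (0 < #|T|)%N.
Implicit Types (g : T -> T -> R).

(** Four-variable quantities are kept as one average over quadruples [(x, u, y, v)], so that a
    pointwise bound passes to averages in one step. The lemmas [avg4_ij] integrate out the two
    coordinates other than [i] and [j]. *)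
Lemma avg4E (F : T -> T -> T -> T -> R) :
  avg (fun p : T * T * T * T => F p.1.1.1 p.1.1.2 p.1.2 p.2) =
  \avg_ x \avg_ u \avg_ y \avg_ v F x u y v.
Proof.
rewrite (avg_pair (fun p : T * T * T => F p.1.1 p.1.2 p.2)).
rewrite (avg_pair (fun (p : T * T) y => \avg_ v F p.1 p.2 y v)).
by rewrite (avg_pair (fun x u => \avg_ y \avg_ v F x u y v)).
Qed.

Lemma avg4_12 g :
  avg (fun p : T * T * T * T => g p.1.1.1 p.1.1.2) = \avg_ x \avg_ y g x y.
Proof.
rewrite (avg4E (fun x u _ _ => g x u)); apply: eq_avg => x; apply: eq_avg => u.
by rewrite !avg_cst.
Qed.

Lemma avg4_34 g :
  avg (fun p : T * T * T * T => g p.1.2 p.2) = \avg_ x \avg_ y g x y.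
Proof. by rewrite (avg4E (fun _ _ y v => g y v)) !avg_cst. Qed.

Lemma avg4_13 g :
  avg (fun p : T * T * T * T => g p.1.1.1 p.1.2) = \avg_ x \avg_ y g x y.
Proof.
rewrite (avg4E (fun x _ y _ => g x y)); apply: eq_avg => x.
by rewrite avg_cst //; apply: eq_avg => y; rewrite avg_cst.
Qed.

Lemma avg4_14 g :
  avg (fun p : T * T * T * T => g p.1.1.1 p.2) = \avg_ x \avg_ y g x y.
Proof.
by rewrite (avg4E (fun x _ _ v => g x v)); apply: eq_avg => x; rewrite !avg_cst.
Qed.

Lemma avg4_23 g :
  avg (fun p : T * T * T * T => g p.1.1.2 p.1.2) = \avg_ x \avg_ y g x y.
Proof.
rewrite (avg4E (fun _ u y _ => g u y)) avg_cst //.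
by apply: eq_avg => u; apply: eq_avg => y; rewrite avg_cst.
Qed.

Lemma avg4_24 g :
  avg (fun p : T * T * T * T => g p.1.1.2 p.2) = \avg_ x \avg_ y g x y.
Proof.
rewrite (avg4E (fun _ u _ v => g u v)) avg_cst //.
by apply: eq_avg => u; rewrite avg_cst.
Qed.

Lemma avg4_swap34 (F : T -> T -> T -> T -> R) :
  avg (fun p : T * T * T * T => F p.1.1.1 p.1.1.2 p.2 p.1.2) =
  avg (fun p : T * T * T * T => F p.1.1.1 p.1.1.2 p.1.2 p.2).
Proof.
rewrite (avg4E F) (avg4E (fun x u y v => F x u v y)).
by apply: eq_avg => x; apply: eq_avg => u; rewrite exchange_avg.
Qed.

End QuadrupleAverage.

(** * Contraction of cross ratios *)

Section PositivePart.
Variable R : realFieldType.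
Implicit Types s t : R.

Definition pospart t : R := Num.max 0 t.

Lemma pospart_ge0 t : 0 <= pospart t.
Proof. by rewrite le_max lexx. Qed.

Lemma le_pospart t : t <= pospart t.
Proof. by rewrite le_max lexx orbT. Qed.

Lemma pospart_le t s : 0 <= s -> t <= s -> pospart t <= s.
Proof. by rewrite ge_max => -> ->. Qed.

(** The product is negative only if exactly one factor is, and then its size is at most [M] times
    the negative part of that factor. *)
Lemma oppM_le_pospart (M s t : R) : `|s| <= M -> `|t| <= M ->
  - (s * t) <= M * (pospart (- s) + pospart (- t)).
Proof.
rewrite !ler_norml => /andP[Ms sM] /andP[Mt tM].
have [p0 p1] := (pospart_ge0 (- s), le_pospart (- s)).
have [r0 r1] := (pospart_ge0 (- t), le_pospart (- t)).
by have [s0|s0] := lerP 0 s; have [t0|t0] := lerP 0 t; nra.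
Qed.

Definition contract (K : R) : R := (K ^+ 2 + 1) / (2 * K).

(* The identity behind the contraction is
   (K b - a) (K c - d) + (K a - b) (K d - c)
     = (K^2 + 1) (a d + b c) - 2 K (a c + b d). *)
Lemma cross_contract (K B a b c d : R) : 1 <= K ->
  0 <= a <= B -> 0 <= b <= B -> 0 <= c <= B -> 0 <= d <= B ->
  a * c + b * d - contract K * (a * d + b * c) <=
  (K + 1) * B * (pospart (a - K * b) + pospart (b - K * a) +
                 (pospart (c - K * d) + pospart (d - K * c))).
Proof.
move=> K1 /andP[a0 aB] /andP[b0 bB] /andP[c0 cB] /andP[d0 dB].
have bnd x y : 0 <= x -> x <= B -> 0 <= y -> y <= B -> `|K * y - x| <= (K + 1) * B.
  by move=> x0 xB y0 yB; rewrite ler_norml; apply/andP; split; nra.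
have h1 := oppM_le_pospart (bnd _ _ a0 aB b0 bB) (bnd _ _ d0 dB c0 cB).
have h2 := oppM_le_pospart (bnd _ _ b0 bB a0 aB) (bnd _ _ c0 cB d0 dB).
move: h1 h2; rewrite !opprB => h1 h2.
set P := _ + (_ + _); have P0 : 0 <= P by rewrite !addr_ge0 ?pospart_ge0.
have K0 : 0 < K by lra.
have -> : a * c + b * d - contract K * (a * d + b * c) =
  (- ((K * b - a) * (K * c - d)) - (K * a - b) * (K * d - c)) / (2 * K).
  by rewrite /contract; field; lra.
rewrite ler_pdivrMr; last lra.
have B0 : 0 <= B by lra.
(* Clearing the denominator leaves a factor [2 * K >= 1] on the right, which may be dropped. *)
apply: (@le_trans _ _ ((K + 1) * B * P)).
  by rewrite /P; move: h1 h2; lra.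
by rewrite ler_peMr ?mulr_ge0 //; lra.
Qed.

Lemma contract_ge1 (K : R) : 1 <= K -> 1 <= contract K.
Proof.
move=> K1; rewrite /contract ler_pdivlMr ?mul1r; last lra.
by have := sqr_ge0 (K - 1); lra.
Qed.

(** The distance of the bound from 1 at least halves, so iteration converges geometrically. *)
Lemma contract_sub1 (K : R) : 1 <= K -> contract K - 1 <= (K - 1) / 2.
Proof.
move=> K1; have -> : contract K - 1 = (K - 1) ^+ 2 / (2 * K).
  by rewrite /contract; field; lra.
by rewrite ler_pdivrMr; [nra | lra].
Qed.

End PositivePart.

(** * Stability of the equation W W^2 = q *)

Definition codeg (R : realFieldType) (T : finType) (W : T -> T -> R) (x y : T) : R :=
  \avg_ z (W x z * W y z).

Definition bounded_kernel (R : realFieldType) (T : finType) (a b : R)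
    (W : T -> T -> R) : Prop :=
  (forall x y, W x y = W y x) /\ (forall x y, a <= W x y <= b).

Definition defect (R : realFieldType) (T : finType) (q : R) (W : T -> T -> R) : R :=
  \avg_ x \avg_ y `|W x y * codeg W x y - q|.

(* This vanishes iff all cross ratios of W are at most K. *)
Definition cross_excess (R : realFieldType) (T : finType) (K : R)
    (W : T -> T -> R) : R :=
  avg (fun p : T * T * T * T =>
    pospart (W p.1.1.1 p.1.2 * W p.1.1.2 p.2 - K * (W p.1.1.1 p.2 * W p.1.1.2 p.1.2))).

(** The mean absolute 2 by 2 minor of [W], which vanishes iff [W] has rank at most one. *)
Definition cross_gap (R : realFieldType) (T : finType) (W : T -> T -> R) : R :=
  avg (fun p : T * T * T * T =>
    `|W p.1.1.1 p.1.2 * W p.1.1.2 p.2 - W p.1.1.1 p.2 * W p.1.1.2 p.1.2|).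

Section Stability.
Variables (R : realFieldType) (T : finType) (a b q : R) (W : T -> T -> R).
Hypothesis T_gt0 : (0 < #|T|)%N.
Hypotheses (a_gt0 : 0 < a) (q_gt0 : 0 < q) (q_le : q <= b ^+ 3).
Hypothesis W_ab : bounded_kernel a b W.

Local Notation W2 := (codeg W).

Let WC x y : W x y = W y x. Proof. by case: W_ab. Qed.
Let W_ge x y : a <= W x y. Proof. by case: W_ab => _ /(_ x y)/andP[]. Qed.
Let W_le x y : W x y <= b. Proof. by case: W_ab => _ /(_ x y)/andP[]. Qed.
Let W_ge0 x y : 0 <= W x y. Proof. exact: le_trans (ltW a_gt0) (W_ge x y). Qed.

Let b_gt0 : 0 < b.
Proof. by case/card_gt0P: T_gt0 => x _; exact: lt_le_trans a_gt0 (le_trans (W_ge x x) (W_le x x)). Qed.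

Let b_ge0 : 0 <= b. Proof. exact: ltW. Qed.

Let W2_ge0 x y : 0 <= W2 x y.
Proof. by apply: avg_ge0 => z; exact: mulr_ge0. Qed.

Let W2_le x y : W2 x y <= b ^+ 2.
Proof. by apply: avg_le => // z; rewrite expr2 ler_pM. Qed.

(** Expand the products of codegrees over [z] and [w] and symmetrise in these two. The integrand
    becomes [a * c + b * d - contract K * (a * d + b * c)] with [a = W x z * W u w],
    [b = W x w * W u z], [c = W y z * W v w], [d = W y w * W v z], the situation of
    [cross_contract]. The error splits into a term in [(x, u)] and one in [(y, v)], each averaging
    to [2 * cross_excess K W]. *)
Lemma cross_excess_codeg K : 1 <= K ->
  avg (fun p : T * T * T * T => pospart (W2 p.1.1.1 p.1.2 * W2 p.1.1.2 p.2
     - contract K * (W2 p.1.1.1 p.2 * W2 p.1.1.2 p.1.2))) <=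
  2 * ((K + 1) * b ^+ 2) * cross_excess K W.
Proof.
move=> K1.
pose e x u z w := pospart (W x z * W u w - K * (W x w * W u z)).
pose G x u := \avg_ z \avg_ w (e x u z w + e x u w z).
have avgG : \avg_ x \avg_ u G x u = 2 * cross_excess K W.
  have -> : cross_excess K W = \avg_ x \avg_ u \avg_ z \avg_ w e x u z w.
    by rewrite /cross_excess (avg4E e).
  rewrite -avgZ; apply: eq_avg => x; rewrite -avgZ; apply: eq_avg => u.
  rewrite /G (@eq_avg _ _ _ (fun z => \avg_ w e x u z w + \avg_ w e x u w z)).
    by rewrite avgD (exchange_avg (fun z w => e x u w z)) mulr2n mulrDl mul1r.
  by move=> z; rewrite avgD.
have K0 : 0 <= (K + 1) * b ^+ 2 by rewrite mulr_ge0 ?sqr_ge0 //; lra.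
have G0 x u : 0 <= G x u.
  by apply: avg_ge0 => z; apply: avg_ge0 => w; rewrite addr_ge0 ?pospart_ge0.
have key x u y v : W2 x y * W2 u v - contract K * (W2 x v * W2 u y) <=
    (K + 1) * b ^+ 2 / 2 * (G x u + G y v).
  have prodE s t s' t' : W2 s t * W2 s' t' =
      \avg_ z \avg_ w (W s z * W t z * (W s' w * W t' w)).
    rewrite /codeg -avgZr; apply: eq_avg => z; rewrite -avgZ.
    by apply: eq_avg.
  have prodE' s t s' t' : W2 s t * W2 s' t' =
      \avg_ z \avg_ w (W s w * W t w * (W s' z * W t' z)).
    by rewrite prodE exchange_avg.
  have dbl s t s' t' : 2 * (W2 s t * W2 s' t') = \avg_ z \avg_ w
      (W s z * W t z * (W s' w * W t' w) + W s w * W t w * (W s' z * W t' z)).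
    rewrite (@eq_avg _ _ _ (fun z => \avg_ w (W s z * W t z * (W s' w * W t' w)) +
        \avg_ w (W s w * W t w * (W s' z * W t' z)))); last by move=> z; rewrite avgD.
    by rewrite avgD -prodE -prodE' mulr2n mulrDl mul1r.
  suff : 2 * (W2 x y * W2 u v) - contract K * (2 * (W2 x v * W2 u y)) <=
         (K + 1) * b ^+ 2 * (G x u + G y v) by lra.
  rewrite !dbl /G -!avgZ -avgD -avgB -avgZ; apply: ler_avg => z.
  rewrite -!avgZ -avgD -avgB -avgZ; apply: ler_avg => w.
  have bnd s t s' t' : 0 <= W s t * W s' t' <= b ^+ 2.
    by rewrite mulr_ge0 //= expr2 ler_pM.
  have := cross_contract K1 (bnd x z u w) (bnd x w u z) (bnd y z v w) (bnd y w v z).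
  by rewrite /e; congr (_ <= _); ring.
apply: le_trans (ler_avg (g := fun p : T * T * T * T =>
   (K + 1) * b ^+ 2 / 2 * (G p.1.1.1 p.1.1.2 + G p.1.2 p.2)) _) _.
  move=> p; apply: pospart_le; last exact: key.
  by rewrite mulr_ge0 ?divr_ge0 ?addr_ge0.
by rewrite avgZ avgD avg4_12 // avg4_34 // avgG; lra.
Qed.

(** Up to the defect, [W] is [q / W2], so a cross ratio of [W] is the corresponding one of [W2] with
    [y] and [v] exchanged. The contracted bound for [W2] thus returns to [W]. *)
Lemma cross_excess_step K : 1 <= K ->
  cross_excess (contract K) W <=
  q ^- 2 * (b ^+ 4 * (2 * ((K + 1) * b ^+ 2) * cross_excess K W) +
            2 * (b ^+ 5 * (1 + contract K)) * defect q W).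
Proof.
move=> K1; have psi1 := contract_ge1 K1.
move: (contract K) (cross_excess_codeg K1) psi1 => psi hX psi1.
have psi0 : 0 <= psi := le_trans ler01 psi1.
have b4 : b ^+ 4 = b ^+ 2 * b ^+ 2 by rewrite -exprD.
have b5 : b ^+ 5 = b ^+ 2 * b ^+ 3 by rewrite -exprD.
pose e x y := `|W x y * W2 x y - q|.
have Wp x y : 0 <= W x y * W2 x y <= b ^+ 3.
  by rewrite mulr_ge0 //= exprS ler_pM.
have prod_e x y u v :
    `|q ^+ 2 - (W x y * W2 x y) * (W u v * W2 u v)| <= b ^+ 3 * (e x y + e u v).
  set s := W x y * _; set t := W u v * _.
  have -> : q ^+ 2 - s * t = - (q * (s - q)) - s * (t - q) by ring.
  apply: le_trans (ler_normB _ _) _; rewrite normrN (normrM q) (normrM s) mulrDr lerD //.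
    by rewrite (ger0_norm (ltW q_gt0)) ler_wpM2r.
  by case/andP: (Wp x y) => s0 sb; rewrite (ger0_norm s0) ler_wpM2r.
pose X x u y v := pospart (W2 x y * W2 u v - psi * (W2 x v * W2 u y)).
have key x u y v : q ^+ 2 * pospart (W x v * W u y - psi * (W x y * W u v)) <=
   b ^+ 4 * X x u y v +
   b ^+ 5 * ((e x y + e u v) + psi * (e x v + e u y)).
  have e0 s t : 0 <= e s t by exact: normr_ge0.
  have X0 : 0 <= X x u y v by exact: pospart_ge0.
  have q20 : 0 < q ^+ 2 by rewrite exprn_gt0.
  rewrite -ler_pdivlMl //; apply: pospart_le.
    apply: mulr_ge0; first by rewrite invr_ge0 ltW.
    rewrite addr_ge0 ?mulr_ge0 ?exprn_ge0 ?addr_ge0 ?mulr_ge0 ?addr_ge0 //.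
  rewrite ler_pdivlMl //.
  have bnd s t s' t' : 0 <= W s t * W s' t' <= b ^+ 2.
    by rewrite mulr_ge0 //= expr2 ler_pM.
  have /andP[P0 Pb] := bnd x y u v; have /andP[S0 Sb] := bnd x v u y.
  have h1 := prod_e x y u v; have h2 := prod_e x v u y.
  (* Replacing each [q ^+ 2] by a product of two values of [W * W2] leaves the cross difference of
     [W2], with a weight at most [b ^+ 4], and two errors. These are at most [b ^+ 2] times the
     bound of [prod_e], whence [b ^+ 5]. *)
  have -> : q ^+ 2 * (W x v * W u y - psi * (W x y * W u v)) =
    (W x y * W u v) * (W x v * W u y) * (W2 x y * W2 u v - psi * (W2 x v * W2 u y)) +
    ((W x v * W u y) * (q ^+ 2 - (W x y * W2 x y) * (W u v * W2 u v)) -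
     psi * (W x y * W u v) * (q ^+ 2 - (W x v * W2 x v) * (W u y * W2 u y))) by ring.
  apply: lerD.
    apply: (le_trans (y := (W x y * W u v) * (W x v * W u y) * X x u y v)).
      by rewrite ler_wpM2l ?mulr_ge0 // le_pospart.
    by rewrite ler_wpM2r // b4 ler_pM.
  apply: le_trans (ler_norm _) _; apply: le_trans (ler_normB _ _) _.
  rewrite [leRHS]mulrDr; apply: lerD.
    rewrite normrM (ger0_norm S0) b5 -[leRHS]mulrA.
    by rewrite ler_pM.
  rewrite (normrM (psi * _)) (normrM psi) (ger0_norm P0) (ger0_norm psi0).
  rewrite [leRHS]mulrCA -[leLHS]mulrA ler_wpM2l //.
  by rewrite b5 -[leRHS]mulrA ler_pM.
rewrite ler_pdivlMl ?exprn_gt0 //.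
rewrite /cross_excess -(avg4_swap34 (fun x u y v =>
   pospart (W x y * W u v - psi * (W x v * W u y)))) -avgZ.
apply: le_trans (ler_avg (g := fun p : T * T * T * T =>
   b ^+ 4 * X p.1.1.1 p.1.1.2 p.1.2 p.2 + b ^+ 5 *
     ((e p.1.1.1 p.1.2 + e p.1.1.2 p.2) + psi * (e p.1.1.1 p.2 + e p.1.1.2 p.1.2))) _) _.
  by move=> p; exact: key.
rewrite avgD !avgZ !avgD !avgZ !avgD avg4_13 // avg4_24 // avg4_14 // avg4_23 //.
rewrite -/(defect q W); apply: lerD; first by rewrite ler_wpM2l ?exprn_ge0 // ltW.
by rewrite le_eqVlt; apply/orP; left; apply/eqP; ring.
Qed.

(** Entries between [a] and [b] have cross ratios at most [b ^+ 2 / a ^+ 2]; this starts the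
    iteration. *)
Lemma cross_excess_init : cross_excess (b ^+ 2 / a ^+ 2) W = 0.
Proof.
rewrite /cross_excess (@eq_avg _ _ _ (fun=> 0)) ?avg_cst //.
  by rewrite !card_prod !muln_gt0 T_gt0.
move=> p; apply/max_idPl; rewrite subr_le0 [leRHS]mulrAC.
rewrite ler_pdivlMr ?exprn_gt0 // !expr2; apply: ler_pM; rewrite ?mulr_ge0 ?(ltW a_gt0) //.
  by rewrite ler_pM.
by rewrite ler_pM ?(ltW a_gt0).
Qed.

(** Write [P - S = (P - K * S) + (K - 1) * S] for the two products [P] and [S], and likewise with
    [P] and [S] exchanged. *)
Lemma cross_excess1 K : 1 <= K ->
  cross_gap W <=
  2 * cross_excess K W + (K - 1) * b ^+ 2.
Proof.
move=> K1.
pose e x u y v := pospart (W x y * W u v - K * (W x v * W u y)).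
apply: le_trans (ler_avg (g := fun p : T * T * T * T =>
   e p.1.1.1 p.1.1.2 p.1.2 p.2 + e p.1.1.1 p.1.1.2 p.2 p.1.2 + (K - 1) * b ^+ 2) _) _.
  case=> [[[x u] y] v] /=.
  have bnd s t s' t' : 0 <= W s t * W s' t' <= b ^+ 2.
    by rewrite mulr_ge0 //= expr2 ler_pM.
  have /andP[P0 Pb] := bnd x y u v; have /andP[S0 Sb] := bnd x v u y.
  have h1 := le_pospart (W x y * W u v - K * (W x v * W u y)).
  have h2 := le_pospart (W x v * W u y - K * (W x y * W u v)).
  have g1 := pospart_ge0 (W x y * W u v - K * (W x v * W u y)).
  have g2 := pospart_ge0 (W x v * W u y - K * (W x y * W u v)).
  rewrite -/(e x u y v) -/(e x u v y) in h1 h2 g1 g2.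
  by rewrite ler_norml; apply/andP; split; nra.
rewrite !avgD avg4_swap34 avg_cst; last by rewrite !card_prod !muln_gt0 T_gt0.
by rewrite mulr_natl mulr2n.
Qed.

(** Small minors make [W2 x y / W x y] nearly independent of [x]. As [W * W2] is nearly [q], so is
    [W x y] itself, and by symmetry [W] hardly varies in either argument. Then [W2] is close to the
    pointwise square of [W], so [W ^+ 3] is close to [p ^+ 3]. *)
Lemma near_constant p : 0 < p -> p ^+ 3 = q ->
  \avg_ x \avg_ y `|W x y - p| <=
  a ^- 2 * (defect q W + b ^+ 4 / (a * q) * (2 * defect q W + b * cross_gap W)).
Proof.
move=> p_gt0 pq; set C := cross_gap W; have c_gt0 : 0 < a * q by rewrite mulr_gt0.
pose e x y := `|W x y * W2 x y - q|.
pose c4 x u y v := `|W x y * W u v - W x v * W u y|.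
pose L := \avg_ x \avg_ u \avg_ y `|W x y - W u y|.
have e0 x y : 0 <= e x y by exact: normr_ge0.
have diff2 x u y : `|W2 x y * W u y - W x y * W2 u y| <= b * \avg_ z c4 x u y z.
  rewrite /codeg -avgZr -avgZ -avgB -avgZ; apply: le_trans (ler_norm_avg _) _.
  apply: ler_avg => z; rewrite /c4.
  have -> : W x z * W y z * W u y - W x y * (W u z * W y z) =
     - (W y z * (W x y * W u z - W x z * W u y)) by ring.
  by rewrite normrN normrM (ger0_norm (W_ge0 _ _)) ler_wpM2r.
have key x u y : `|W x y - W u y| <=
    b ^+ 2 / (2 * (a * q)) * (e x y + e u y + b * \avg_ z c4 x u y z).
  have h := diff2 x u y.
  rewrite mulrAC ler_pdivlMr; last lra.
  (* The difference of squares is used because its other factor [W u y + W x y] is at least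
     [2 * a]. *)
  have sq : q * (W u y ^+ 2 - W x y ^+ 2) =
      W x y * W u y * (W2 x y * W u y - W x y * W2 u y) +
      (W x y ^+ 2 * (W u y * W2 u y - q) - W u y ^+ 2 * (W x y * W2 x y - q)) by ring.
  have le1 : q * `|W u y ^+ 2 - W x y ^+ 2| <=
      b ^+ 2 * (e x y + e u y + b * \avg_ z c4 x u y z).
    rewrite -{1}(gtr0_norm q_gt0) -normrM sq; apply: le_trans (ler_normD _ _) _.
    rewrite [leRHS]mulrDr [leLHS]addrC; apply: lerD; last first.
      rewrite normrM; apply: ler_pM => //.
      by rewrite ger0_norm ?mulr_ge0 // expr2 ler_pM.
    apply: le_trans (ler_normB _ _) _; rewrite [leLHS]addrC [leRHS]mulrDr.
    have sqb s t : `|W s t ^+ 2| <= b ^+ 2.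
      by rewrite ger0_norm ?sqr_ge0 // ler_pXn2r ?nnegrE // ltW.
    by apply: lerD; rewrite normrM; apply: ler_pM.
  apply: le_trans le1.
  have sum_ge : 2 * a <= W u y + W x y by have := W_ge x y; have := W_ge u y; lra.
  rewrite subr_sqr normrM distrC (ger0_norm (addr_ge0 (W_ge0 u y) (W_ge0 x y))).
  by have := ler_wpM2l (ltW q_gt0) (ler_wpM2l (normr_ge0 (W u y - W x y)) sum_ge); lra.
have LE : L <= b ^+ 2 / (2 * (a * q)) * (2 * defect q W + b * C).
  have -> : L = avg (fun p : T * T * T * T => `|W p.1.1.1 p.1.2 - W p.1.1.2 p.1.2|).
    rewrite (avg4E (fun x u y _ => `|W x y - W u y|)).
    apply: eq_avg => x; apply: eq_avg => u; apply: eq_avg => y.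
    by rewrite avg_cst.
  apply: le_trans (ler_avg (fun p => key p.1.1.1 p.1.1.2 p.1.2)) _.
  rewrite avgZ !avgD avgZ avg4_13 // avg4_23 // -/(defect q W).
  have -> : avg (fun p : T * T * T * T => \avg_ z c4 p.1.1.1 p.1.1.2 p.1.2 z) = C.
    rewrite (avg4E (fun x u y _ => \avg_ z c4 x u y z)) /C /cross_gap (avg4E c4).
    apply: eq_avg => x; apply: eq_avg => u; apply: eq_avg => y.
    by rewrite avg_cst.
  by rewrite [2 * defect _ _]mulr_natl mulr2n.
(* Symmetry of [W] turns variation in the second argument, and variation along [W y z] against
   [W x y], into the first-argument variation [L]. *)
have L1 : \avg_ x \avg_ y \avg_ z `|W x z - W x y| = L.
  rewrite /L exchange_avg; under [RHS]eq_avg => x do rewrite exchange_avg.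
  rewrite [RHS]exchange_avg exchange_avg.
  apply: eq_avg => x; rewrite exchange_avg; apply: eq_avg => y; apply: eq_avg => z.
  by rewrite [W z x]WC [W y x]WC.
have L2 : \avg_ x \avg_ y \avg_ z `|W y z - W x y| = L.
  apply: eq_avg => x; rewrite exchange_avg; apply: eq_avg => z.
  by apply: eq_avg => y; rewrite distrC [W y z]WC.
have fin x y : `|W x y - p| <= a ^- 2 *
    (e x y + b ^+ 2 * (\avg_ z `|W x z - W x y| + \avg_ z `|W y z - W x y|)).
  rewrite ler_pdivlMl ?exprn_gt0 //.
  have cube : a ^+ 2 * `|W x y - p| <= `|W x y ^+ 3 - q|.
    have W0 := W_ge x y.
    have -> : W x y ^+ 3 - q = (W x y - p) * (W x y ^+ 2 + (W x y * p + p ^+ 2)).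
      by rewrite -pq; ring.
    have ge_a2 : a ^+ 2 <= W x y ^+ 2 + (W x y * p + p ^+ 2).
      apply: (@le_trans _ _ (W x y ^+ 2)); first by rewrite ler_pXn2r ?nnegrE // ltW.
      by rewrite lerDl addr_ge0 ?mulr_ge0 ?sqr_ge0 // ltW.
    rewrite normrM mulrC ler_wpM2l //.
    by rewrite ger0_norm // (le_trans _ ge_a2) // sqr_ge0.
  apply: le_trans cube _.
  have -> : W x y ^+ 3 - q = (W x y * W2 x y - q) -
      W x y * \avg_ z (W x z * W y z - W x y ^+ 2).
    by rewrite avgB avg_cst //; rewrite /codeg; ring.
  apply: le_trans (ler_normB _ _) _; rewrite lerD2l normrM (ger0_norm (W_ge0 _ _)).
  rewrite (_ : b ^+ 2 = b * b) -?expr2 // -mulrA.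
  apply: ler_pM => //; rewrite -avgD -avgZ; apply: le_trans (ler_norm_avg _) _.
  apply: ler_avg => z.
  have -> : W x z * W y z - W x y ^+ 2 =
    W y z * (W x z - W x y) + W x y * (W y z - W x y) by ring.
  apply: le_trans (ler_normD _ _) _; rewrite !normrM !(ger0_norm (W_ge0 _ _)) mulrDr.
  by apply: lerD; rewrite ler_wpM2r.
apply: le_trans (ler_avg (fun x => ler_avg (fin x))) _.
rewrite (@eq_avg _ _ _ (fun x => a ^- 2 * (\avg_ y e x y + b ^+ 2 *
   (\avg_ y \avg_ z `|W x z - W x y| + \avg_ y \avg_ z `|W y z - W x y|)))); last first.
  by move=> x; rewrite avgZ avgD avgZ avgD.
rewrite avgZ avgD avgZ avgD L1 L2 ler_wpM2l ?invr_ge0 ?sqr_ge0 // lerD2l.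
(* The factor 2 counts the two variations [L1] and [L2], the factor [b ^+ 2] is that of [fin], and
   the rest is the coefficient in [LE]. *)
have -> : b ^+ 4 / (a * q) = 2 * b ^+ 2 * (b ^+ 2 / (2 * (a * q))).
  by field; rewrite ?lt0r_neq0.
move: LE; set k := b ^+ 2 / (2 * (a * q)); set X := _ + _ => LE.
by move: k X LE => k X LE; have := ler_wpM2l (sqr_ge0 b) LE; lra.
Qed.

End Stability.

(** * Iterating the contraction *)

Lemma exprn_small (R : archiRealFieldType) (r eps : R) :
  0 <= r < 1 -> 0 < eps -> exists m, r ^+ m <= eps.
Proof.
case/andP=> r0 r1 eps0.
(* A Bernoulli inequality; it makes [m > 1 / (eps * (1 - r))] sufficient. *)
have bern m : r ^+ m * (1 + m%:R * (1 - r)) <= 1.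
  elim: m => [|m IH]; first by rewrite mul0r addr0 mulr1.
  apply: le_trans IH; rewrite exprSr -mulrA ler_wpM2l ?exprn_ge0 //.
  rewrite -natr1; have := sqr_ge0 (1 - r).
  by have := mulr_ge0 (ler0n R m) (sqr_ge0 (1 - r)); lra.
have h0 : 0 < eps * (1 - r) by rewrite mulr_gt0 // subr_gt0.
pose m := Num.Def.archi_bound (eps * (1 - r))^-1; exists m.
have : (eps * (1 - r))^-1 < m%:R by apply: archi_boundP; rewrite invr_ge0 ltW.
rewrite -[X in X < _]mul1r ltr_pdivrMr // => hm.
have := bern m; have : 0 <= r ^+ m by rewrite exprn_ge0.
by have := ler0n R m; nra.
Qed.

Section StableEquation.
Variables (R : archiRealFieldType) (a b q : R).
Hypotheses (a_gt0 : 0 < a) (a_le : a <= b) (q_gt0 : 0 < q) (q_le : q <= b ^+ 3).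

(** [K] and [C] are chosen before [T] and [W], which makes the final bounds uniform over all graphs.
    Each step halves the bound on [K - 1] at the price of a new [C]. *)
Lemma cross_excess_iter i : exists K : R,
  1 <= K <= 1 + (b ^+ 2 / a ^+ 2 - 1) / 2 ^+ i /\
  exists2 C : R, 0 <= C & forall (T : finType) (W : T -> T -> R),
    (0 < #|T|)%N -> bounded_kernel a b W -> cross_excess K W <= C * defect q W.
Proof.
elim: i => [|i [K [/andP[K1 Kle] [C C0 IH]]]].
  exists (b ^+ 2 / a ^+ 2); split.
    rewrite expr0 divr1 addrC subrK lexx andbT ler_pdivlMr ?exprn_gt0 // mul1r.
    by rewrite ler_pXn2r ?nnegrE // ltW // (lt_le_trans a_gt0).
  exists 0 => // T W T0 WW.
  by rewrite (cross_excess_init T0 a_gt0 WW) mul0r.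
have b0 : 0 <= b := le_trans (ltW a_gt0) a_le.
have psi1 := contract_ge1 K1.
exists (contract K); split.
  rewrite psi1 -lerBlDl; apply: le_trans (contract_sub1 K1) _.
  by rewrite [2 ^+ i.+1]exprSr [(2 ^+ i * 2)^-1]invfM mulrA ler_wpM2r //; lra.
exists (q ^- 2 * (b ^+ 4 * (2 * ((K + 1) * b ^+ 2) * C) + 2 * (b ^+ 5 * (1 + contract K)))).
  have q20 : 0 <= q ^- 2 by rewrite invr_ge0 sqr_ge0.
  by rewrite mulr_ge0 // addr_ge0 // !mulr_ge0 ?exprn_ge0 //; lra.
move=> T W T0 WW; apply: le_trans (cross_excess_step T0 a_gt0 q_gt0 q_le WW K1) _.
rewrite -[leRHS]mulrA ler_wpM2l ?invr_ge0 ?sqr_ge0 // [leRHS]mulrDl lerD2r -!mulrA.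
by rewrite ler_wpM2l ?exprn_ge0 // !ler_wpM2l ?exprn_ge0 ?IH //; lra.
Qed.

Lemma stable_equation p eps : 0 < p -> p ^+ 3 = q -> 0 < eps ->
  exists2 delta : R, 0 < delta & forall (T : finType) (W : T -> T -> R),
    (0 < #|T|)%N -> bounded_kernel a b W -> defect q W <= delta ->
    \avg_ x \avg_ y `|W x y - p| <= eps.
Proof.
move=> p0 pq eps0; have b0 : 0 < b := lt_le_trans a_gt0 a_le.
have [M M0 ME] : exists2 M, 0 < M & M = b ^+ 4 / (a * q).
  by exists (b ^+ 4 / (a * q)); rewrite // divr_gt0 ?exprn_gt0 ?mulr_gt0.
pose H := b ^+ 2 / a ^+ 2 - 1.
have H0 : 0 <= H.
  by rewrite subr_ge0 ler_pdivlMr ?exprn_gt0 // mul1r ler_pXn2r ?nnegrE // ltW.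
(* After [cross_excess1] is inserted into [near_constant], [F] is the coefficient of [K - 1] and [N]
   below that of the defect. First [i] makes the [F] term at most [eps / 2], then [delta] does so
   for the [N] term. Dividing by [H + 1] avoids division by zero when [a = b]. *)
pose F := a ^- 2 * (M * (b * b ^+ 2)).
have a20 : 0 < a ^- 2 by rewrite invr_gt0 exprn_gt0.
have F0 : 0 < F by apply: mulr_gt0 => //; rewrite mulr_gt0 // mulr_gt0 ?exprn_gt0.
have eps1 : 0 < eps / (2 * F * (H + 1)).
  by rewrite divr_gt0 // !mulr_gt0 //; lra.
have [|i hi] := @exprn_small R 2^-1 _ _ eps1; first by apply/andP; split; lra.
have [K [/andP[K1 Kle] [C C0 hC]]] := cross_excess_iter i.
have FK : F * (K - 1) <= eps / 2.
  apply: (@le_trans _ _ (F * (H * (eps / (2 * F * (H + 1)))))).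
    rewrite ler_wpM2l ?(ltW F0) // lerBlDl; apply: le_trans Kle _.
    by rewrite lerD2l ler_wpM2l // -exprVn.
  have -> : F * (H * (eps / (2 * F * (H + 1)))) = eps / 2 * (H / (H + 1)).
    by field; rewrite !lt0r_neq0 //; lra.
  by rewrite ger_pMr ?divr_gt0 // ler_pdivrMr; lra.
pose N := a ^- 2 * (1 + M * (2 + 2 * b * C)).
have N0 : 0 < N.
  apply: mulr_gt0 => //; apply: ltr_pwDl => //; apply: mulr_ge0 (ltW M0) _.
  by rewrite addr_ge0 // !mulr_ge0 // ltW.
have N20 : 0 < 2 * N by rewrite mulr_gt0.
exists (eps / (2 * N)); first by rewrite divr_gt0.
move=> T W T0 WW; rewrite ler_pdivlMr // => hd.
apply: le_trans (near_constant T0 a_gt0 q_gt0 WW p0 pq) _; rewrite -ME.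
have h1 := le_trans (cross_excess1 T0 a_gt0 WW K1)
  (lerD (ler_wpM2l (ler0n R 2) (hC T W T0 WW)) (lexx _)).
apply: (@le_trans _ _ (N * defect q W + F * (K - 1))); last by move: FK hd; lra.
rewrite /N /F -!mulrA -mulrDr ler_wpM2l ?(ltW a20) //.
have := ler_wpM2l (ltW M0) (ler_wpM2l (ltW b0) h1); lra.
Qed.

End StableEquation.

(** * The cut norm *)

(** Test functions with values in [-1, 1] replace sets, so that bounded factors depending on one
    variable can be absorbed into them. *)
Definition cut_small (R : realFieldType) (T : finType) (c : R) (M : T -> T -> R) : Prop :=
  forall f g : T -> R, (forall x, `|f x| <= 1) -> (forall y, `|g y| <= 1) ->
  `|\avg_ x \avg_ y (M x y * f x * g y)| <= c.

Section CutSmall.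
Variables (R : realFieldType) (T : finType).
Hypothesis T_gt0 : (0 < #|T|)%N.
Implicit Types (M N A B : T -> T -> R) (c d : R).

Lemma eq_cut_small c M N : (forall x y, M x y = N x y) -> cut_small c M -> cut_small c N.
Proof.
move=> MN hM f g hf hg; rewrite (@eq_avg _ _ _ (fun x => \avg_ y (M x y * f x * g y))).
  exact: hM.
by move=> x; apply: eq_avg => y; rewrite MN.
Qed.

Lemma cut_small_le c d M : c <= d -> cut_small c M -> cut_small d M.
Proof. by move=> cd hM f g hf hg; apply: le_trans (hM f g hf hg) cd. Qed.

Lemma cut_smallD c d M N : cut_small c M -> cut_small d N ->
  cut_small (c + d) (fun x y => M x y + N x y).
Proof.
move=> hM hN f g hf hg.
rewrite (@eq_avg _ _ _ (fun x => \avg_ y (M x y * f x * g y) + \avg_ y (N x y * f x * g y))).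
  by rewrite avgD; apply: le_trans (ler_normD _ _) (lerD (hM _ _ hf hg) (hN _ _ hf hg)).
by move=> x; rewrite -avgD; apply: eq_avg => y; rewrite !mulrDl.
Qed.

Lemma cut_smallN c M : cut_small c M -> cut_small c (fun x y => - M x y).
Proof.
move=> hM f g hf hg; rewrite (@eq_avg _ _ _ (fun x => - \avg_ y (M x y * f x * g y))).
  by rewrite avgN normrN; exact: hM.
by move=> x; rewrite -avgN; apply: eq_avg => y; rewrite !mulNr.
Qed.

Lemma cut_small_sum (n : nat) (c : nat -> R) (M : nat -> T -> T -> R) :
  (forall k, cut_small (c k) (M k)) ->
  cut_small (\sum_(k < n) c k) (fun x y => \sum_(k < n) M k x y).
Proof.
move=> hM; elim: n => [|n IH].
  rewrite big_ord0 => f g _ _.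
  rewrite (@eq_avg _ _ _ (fun=> 0)) ?avg_cst ?normr0 // => x.
  by rewrite (@eq_avg _ _ _ (fun=> 0)) ?avg_cst // => y; rewrite big_ord0 !mul0r.
rewrite big_ord_recr /=.
apply: eq_cut_small (cut_smallD IH (hM n)) => x y; by rewrite big_ord_recr.
Qed.

Lemma cut_small_abs M : cut_small (\avg_ x \avg_ y `|M x y|) M.
Proof.
move=> f g hf hg; apply: le_trans (ler_norm_avg _) _; apply: ler_avg => x.
apply: le_trans (ler_norm_avg _) _; apply: ler_avg => y.
rewrite !normrM -mulrA ler_piMr //.
by apply: le_trans (ler_pM _ _ (hf x) (hg y)) _; rewrite ?mulr1.
Qed.

(* codeg A is an average of rectangles, which the test functions absorb. *)
Lemma cut_small_mul_codeg c M A : (forall x y, 0 <= A x y <= 1) ->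
  cut_small c M -> cut_small c (fun x y => M x y * codeg A x y).
Proof.
move=> A01 hM f g hf hg.
have hA h z : (forall x, `|h x| <= 1) -> forall x, `|h x * A x z| <= 1.
  move=> hh x; have /andP[A0 A1] := A01 x z.
  rewrite normrM (ger0_norm A0); apply: le_trans (ler_pM _ _ (hh x) A1) _ => //.
  by rewrite mulr1.
rewrite (@eq_avg _ _ _ (fun x => \avg_ z \avg_ y (M x y * (f x * A x z) * (g y * A y z)))).
  rewrite exchange_avg; apply: le_trans (ler_norm_avg _) _.
  by apply: avg_le => // z; apply: hM; exact: hA.
move=> x; rewrite exchange_avg; apply: eq_avg => y.
rewrite /codeg -avgZ -!avgZr; apply: eq_avg => z; ring.
Qed.

(** Multiplication by [1 - codeg A] is a difference of two operations that each preserve the bound,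
    so it at most doubles it. *)
Lemma cut_small_mul_expr c M A m : (forall x y, 0 <= A x y <= 1) -> cut_small c M ->
  cut_small (2 ^+ m * c) (fun x y => M x y * (1 - codeg A x y) ^+ m).
Proof.
move=> A01 hM; elim: m => [|m IH].
  by rewrite expr0 mul1r; apply: eq_cut_small hM => x y; rewrite mulr1.
have h := cut_smallD IH (cut_smallN (cut_small_mul_codeg A01 IH)).
rewrite exprS -mulrA (_ : 2 * _ = 2 ^+ m * c + 2 ^+ m * c); last by ring.
by apply: eq_cut_small h => x y; rewrite exprSr; ring.
Qed.

(** The sign of the inner average is an admissible test function [f]. *)
Lemma cut_small_avgl c M (g : T -> R) : (forall y, `|g y| <= 1) -> cut_small c M ->
  \avg_ x `|\avg_ y (M x y * g y)| <= c.
Proof.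
move=> hg hM; pose f x := Num.sg (\avg_ y (M x y * g y)).
have hf x : `|f x| <= 1 by rewrite normr_sg; case: (_ != 0).
apply: le_trans (hM f g hf hg); apply: le_trans (ler_norm _).
rewrite le_eqVlt; apply/orP; left; apply/eqP; apply: eq_avg => x.
by rewrite normrEsg -/(f x) -avgZ; apply: eq_avg => y; ring.
Qed.

(** Replace [A] by [U] in one factor at a time. With [x] or [y] fixed, the remaining factor is a
    test function and [cut_small_avgl] applies. As [U] is only bounded by 2 it is halved first,
    whence [3 = 1 + 2]. *)
Lemma avg_abs_codegB c A U : (forall x y, 0 <= A x y <= 1) ->
  (forall x y, 0 <= U x y <= 2) -> cut_small c (fun x y => A x y - U x y) ->
  \avg_ x \avg_ y `|codeg A x y - codeg U x y| <= 3 * c.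
Proof.
move=> A01 U02 hM; pose M x y := A x y - U x y.
have AU x y : codeg A x y - codeg U x y =
   \avg_ z (M x z * A y z) + 2 * \avg_ z (M y z * (U x z / 2)).
  by rewrite /codeg -avgB -avgZ -avgD; apply: eq_avg => z; rewrite /M; field.
have -> : 3 * c = c + 2 * c by ring.
apply: (@le_trans _ _ (\avg_ x \avg_ y (`|\avg_ z (M x z * A y z)|) +
   2 * \avg_ x \avg_ y (`|\avg_ z (M y z * (U x z / 2))|))).
  rewrite -avgZ -avgD; apply: ler_avg => x; rewrite -avgZ -avgD; apply: ler_avg => y.
  by rewrite AU; apply: le_trans (ler_normD _ _) _; rewrite (normrM 2) (ger0_norm (ler0n R 2)).
apply: lerD.
  rewrite exchange_avg; apply: avg_le => // y.
  apply: (@cut_small_avgl c M (fun z => A y z)) => // z.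
  by have /andP[A0 A1] := A01 y z; rewrite ger0_norm.
rewrite ler_wpM2l // ; apply: avg_le => // x.
apply: (@cut_small_avgl c M (fun z => U x z / 2)) => // z.
by have /andP[A0 A1] := U02 x z; rewrite ger0_norm; lra.
Qed.

End CutSmall.

(** * Four-cycles *)

Section FourCycle.
Variables (R : realFieldType) (T : finType) (q delta eps : R) (B : T -> T -> R).
Hypothesis T_gt0 : (0 < #|T|)%N.
Hypotheses (q01 : 0 < q <= 1) (eps_gt0 : 0 < eps) (delta01 : 0 < delta <= 1).
Hypothesis delta_le : 45 * delta <= eps ^+ 4.
Hypothesis BC : forall x y, B x y = B y x.
Hypothesis B_ge : (1 - delta) * q <= \avg_ x \avg_ y B x y.
Hypothesis C4_le : \avg_ x \avg_ y \avg_ z \avg_ w (B x y * B y z * B z w * B w x) <=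
  (1 + delta) * q ^+ 4.

Let deg x := \avg_ y B x y.

(** Two-edge paths, counted by their end points and by their midpoint. *)
Let avg_codeg : \avg_ x \avg_ y codeg B x y = \avg_ x (deg x ^+ 2).
Proof.
rewrite /codeg; under eq_avg => x do rewrite exchange_avg.
rewrite exchange_avg; apply: eq_avg => z; rewrite expr2 /deg -avgZr.
apply: eq_avg => x; rewrite -avgZ; apply: eq_avg => y.
by rewrite [B x z]BC [B y z]BC.
Qed.

Let avg_codeg2 : \avg_ x \avg_ y (codeg B x y ^+ 2) <= (1 + delta) * q ^+ 4.
Proof.
apply: le_trans C4_le; rewrite le_eqVlt; apply/orP; left; apply/eqP.
apply: eq_avg => x; rewrite exchange_avg; apply: eq_avg => y.
rewrite expr2 /codeg -avgZr; apply: eq_avg => z.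
rewrite -avgZ; apply: eq_avg => w.
by rewrite [B y z]BC [B x w]BC; ring.
Qed.

Let m := \avg_ x deg x.
Let s := \avg_ x (deg x ^+ 2).

Let q_gt0 : 0 < q. Proof. by case/andP: q01. Qed.
Let q_le1 : q <= 1. Proof. by case/andP: q01. Qed.
Let delta_gt0 : 0 < delta. Proof. by case/andP: delta01. Qed.
Let delta_le1 : delta <= 1. Proof. by case/andP: delta01. Qed.

Let s_ge : (1 - 2 * delta) * q ^+ 2 <= s.
Proof.
have m0 : 0 <= (1 - delta) * q by rewrite mulr_ge0 // ?subr_ge0 // ltW.
have h : ((1 - delta) * q) ^+ 2 <= m ^+ 2.
  by rewrite ler_pXn2r ?nnegrE //; exact: le_trans m0 B_ge.
apply: le_trans (le_trans h (sqr_avg_le T_gt0 _)).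
rewrite exprMn ler_wpM2r ?sqr_ge0 //.
by have := sqr_ge0 delta; lra.
Qed.

(** [s] is the mean codegree, so by Cauchy-Schwarz its square is at most the 4-cycle density. *)
Let s_le : s <= (1 + delta) * q ^+ 2.
Proof.
have s0 : 0 <= s by apply: avg_ge0 => x; exact: sqr_ge0.
have h : s ^+ 2 <= (1 + delta) * q ^+ 4.
  apply: le_trans avg_codeg2; rewrite /s -avg_codeg.
  apply: le_trans (sqr_avg_le T_gt0 _) _; apply: ler_avg => x; exact: sqr_avg_le.
have d1 : 1 <= 1 + delta by rewrite lerDl ltW.
have X0 : 0 <= (1 + delta) * q ^+ 2 by rewrite mulr_ge0 ?sqr_ge0 // (le_trans ler01 d1).
rewrite -(@ler_pXn2r _ 2) ?nnegrE //.
apply: le_trans h _; rewrite exprMn -exprM ler_wpM2r ?exprn_ge0 ?(ltW q_gt0) //.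
by rewrite expr2 ler_peMl // (le_trans ler01 d1).
Qed.

(** The source of the constant [45 = 5 * 3 ^ 2]: three errors must add up to at most [eps ^+ 2], and
    each has second moment at most [5 * delta]. *)
Let le_third (X : R) : X ^+ 2 <= 5 * delta -> X <= eps ^+ 2 / 3.
Proof.
move=> hX; have [X0|/ltW X0] := lerP X 0.
  by apply: le_trans X0 _; rewrite divr_ge0 ?sqr_ge0.
rewrite -(@ler_pXn2r _ 2) ?nnegrE ?divr_ge0 ?sqr_ge0 //.
apply: le_trans hX _; rewrite expr_div_n -exprM ler_pdivlMr ?exprn_gt0 //.
by move: delta_le; lra.
Qed.

(** Expanding the second moment about [q ^+ 2] gives at most [(1 + delta) - 2 * (1 - 2 * delta) + 1
    = 5 * delta] times [q ^+ 4]. *)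
Let avg_abs_codeg : \avg_ x \avg_ y `|codeg B x y - q ^+ 2| <= eps ^+ 2 / 3.
Proof.
apply: le_third; apply: (@le_trans _ _ (\avg_ x \avg_ y (codeg B x y - q ^+ 2) ^+ 2)).
  apply: le_trans (sqr_avg_le T_gt0 _) _; apply: ler_avg => x.
  apply: le_trans (sqr_avg_le T_gt0 _) _; apply: ler_avg => y.
  by rewrite real_normK ?num_real.
rewrite (@eq_avg _ _ _ (fun x => \avg_ y (codeg B x y ^+ 2) -
    (2 * q ^+ 2 * (\avg_ y codeg B x y) - q ^+ 4))); last first.
  move=> x; rewrite -avgZ -[X in _ - (_ - X)](avg_cst T_gt0) -!avgB.
  by apply: eq_avg => y; ring.
rewrite avgB avgB avgZ avg_cst // avg_codeg -/s.
have q41 : delta * q ^+ 4 <= delta by rewrite ler_piMr ?(ltW delta_gt0) // exprn_ile1 // ltW.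
by have := ler_wpM2l (sqr_ge0 q) s_ge; move: avg_codeg2; lra.
Qed.

Let avg_abs_deg : \avg_ x `|deg x - q| <= eps ^+ 2 / 3.
Proof.
apply: le_third; apply: (@le_trans _ _ (\avg_ x (deg x - q) ^+ 2)).
  apply: le_trans (sqr_avg_le T_gt0 _) _; apply: ler_avg => x.
  by rewrite real_normK ?num_real.
rewrite (@eq_avg _ _ _ (fun x => deg x ^+ 2 - (2 * q * deg x - q ^+ 2))); last first.
  by move=> x; ring.
rewrite avgB avgB avgZ avg_cst // -/s -/m.
have q21 : delta * q ^+ 2 <= delta by rewrite ler_piMr ?(ltW delta_gt0) // exprn_ile1 // ltW.
have := ler_wpM2l (ltW q_gt0) B_ge; rewrite -/m.
by move: s_le delta_gt0; lra.
Qed.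

(** Cauchy-Schwarz in [x] removes [f]. Expanding the square [h x ^+ 2] leaves the Gram kernel of
    [B - q] tested against [g], and its L1 norm is controlled by the deviations of codegrees and
    degrees. *)
Lemma cut_small_of_C4 : cut_small eps (fun x y => B x y - q).
Proof.
move=> f g hf hg; case/andP: q01 => q0 q1.
pose M x y := B x y - q; pose h x := \avg_ y (M x y * g y).
have hM x y : \avg_ z (M z x * M z y) =
   (codeg B x y - q ^+ 2) - (q * (deg x - q) + q * (deg y - q)).
  rewrite /codeg /deg.
  have -> : q * (\avg_ z B x z - q) + q * (\avg_ z B y z - q) =
     \avg_ z (q * B x z + q * B y z - 2 * q ^+ 2).
    by rewrite avgB avgD !avgZ avg_cst //; ring.
  rewrite -{1}[q ^+ 2](avg_cst T_gt0) -!avgB; apply: eq_avg => z.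
  by rewrite /M [B z x]BC [B z y]BC; ring.
have hh : \avg_ x (h x ^+ 2) <= eps ^+ 2.
  have -> : \avg_ x (h x ^+ 2) = \avg_ y \avg_ z ((\avg_ x (M x y * M x z)) * (g y * g z)).
    rewrite (@eq_avg _ _ _ (fun x => \avg_ y \avg_ z (M x y * M x z * (g y * g z)))).
      rewrite exchange_avg; apply: eq_avg => y; rewrite exchange_avg.
      by apply: eq_avg => z; rewrite avgZr.
    move=> x; rewrite expr2 /h -avgZr; apply: eq_avg => y; rewrite -avgZ.
    by apply: eq_avg => z; ring.
  apply: (@le_trans _ _ (\avg_ y \avg_ z (`|codeg B y z - q ^+ 2| +
      (`|deg y - q| + `|deg z - q|)))).
    apply: ler_avg => y; apply: ler_avg => z; apply: le_trans (ler_norm _) _.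
    rewrite hM normrM; apply: (@le_trans _ _ (`|codeg B y z - q ^+ 2 -
      (q * (deg y - q) + q * (deg z - q))|)).
      rewrite ler_piMr // normrM; apply: le_trans (ler_pM _ _ (hg y) (hg z)) _ => //.
      by rewrite mulr1.
    apply: le_trans (ler_normB _ _) _; rewrite lerD2l.
    apply: le_trans (ler_normD _ _) _; rewrite !normrM (gtr0_norm q0).
    by apply: lerD; rewrite ler_piMl.
  rewrite (@eq_avg _ _ _ (fun y => \avg_ z `|codeg B y z - q ^+ 2| +
     (`|deg y - q| + \avg_ z `|deg z - q|))); last first.
    by move=> y; rewrite avgD avgD avg_cst.
  rewrite !avgD avg_cst //.
  by move: avg_abs_codeg avg_abs_deg; rewrite -/deg; lra.
rewrite (@eq_avg _ _ _ (fun x => h x * f x)); last first.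
  by move=> x; rewrite /h -avgZr; apply: eq_avg => y; rewrite /M; ring.
rewrite -(@ler_pXn2r _ 2) ?nnegrE ?(ltW eps_gt0) // real_normK ?num_real //.
apply: le_trans (sqr_avg_le T_gt0 _) _; apply: le_trans _ hh; apply: ler_avg => x.
by rewrite exprMn ler_piMr ?sqr_ge0 // -real_normK ?num_real // expr_le1.
Qed.

End FourCycle.

(** * The reciprocal of the codegree *)

Section Reciprocal.
Variables (R : archiRealFieldType) (q : R).
Hypothesis q01 : 0 < q <= 1.

Let q_gt0 : 0 < q. Proof. by case/andP: q01. Qed.
Let q_le1 : q <= 1. Proof. by case/andP: q01. Qed.

Definition low_codeg (T : finType) (A : T -> T -> R) (x y : T) : R :=
  (codeg A x y < q / 2)%R%:R.

(** The kernel q / D, with D truncated from below at q / 2 to keep it bounded; it agrees with q / D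
    wherever [low_codeg] vanishes. *)
Definition recip_codeg (T : finType) (A : T -> T -> R) (x y : T) : R :=
  q / Num.max (codeg A x y) (q / 2).

Section Kernel.
Variables (T : finType) (A : T -> T -> R).
Hypotheses (T_gt0 : (0 < #|T|)%N) (A01 : forall x y, 0 <= A x y <= 1).

Local Notation D := (codeg A).
Local Notation rho := (1 - q / 2).

Let D01 x y : 0 <= D x y <= 1.
Proof.
apply/andP; split.
  by apply: avg_ge0 => z; have /andP[? _] := A01 x z; have /andP[? _] := A01 y z; rewrite mulr_ge0.
apply: avg_le => // z; have /andP[? ?] := A01 x z; have /andP[? ?] := A01 y z.
by rewrite -[leRHS]mulr1 ler_pM.
Qed.

Let rho0 : 0 <= rho. Proof. by move: q_gt0 q_le1; lra. Qed.

Lemma bounded_recip_codeg : bounded_kernel q 2 (recip_codeg A).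
Proof.
split=> x y.
  rewrite /recip_codeg; congr (_ / Num.max _ _).
  by apply: eq_avg => z; rewrite mulrC.
have /andP[D0 D1] := D01 x y; rewrite /recip_codeg; set H := Num.max _ _.
have H0 : q / 2 <= H by rewrite le_max lexx orbT.
have H1 : H <= 1 by rewrite ge_max D1 /=; move: q_le1; lra.
have Hp : 0 < H by move: q_gt0; lra.
rewrite ler_pdivlMr // ler_pdivrMr //; apply/andP; split; last lra.
by rewrite ler_piMr // ltW.
Qed.

(* (1 - D)^m is exponentially larger where D < q/2 than where D >= q,
   so testing A D - q <= D - q against it detects the former region. *)
Lemma avg_low_codeg_le c m : cut_small c (fun x y => A x y * D x y - q) ->
  q / 2 * rho ^+ m * (\avg_ x \avg_ y low_codeg A x y) <= 2 ^+ m * c + (1 - q) ^+ m.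
Proof.
move=> hM; rewrite -avgZ.
have h1 : forall x : T, `|(fun=> 1 : R) x| <= 1 by move=> x; rewrite normr1.
have := cut_small_mul_expr T_gt0 m A01 hM h1 h1; clear h1.
set X := \avg_ x _ => hX.
apply: (@le_trans _ _ (- X + (1 - q) ^+ m)); last first.
  by rewrite lerD2r (le_trans _ hX) // -normrN ler_norm.
rewrite -[(1 - q) ^+ m](avg_cst T_gt0) /X -avgN -avgD; apply: ler_avg => x.
rewrite -avgZ -[(1 - q) ^+ m](avg_cst T_gt0) -avgN -avgD; apply: ler_avg => y.
have [q0 q1] := (q_gt0, q_le1).
have /andP[D0 D1] := D01 x y; have /andP[A0 A1] := A01 x y.
have E0 : 0 <= (1 - D x y) ^+ m by rewrite exprn_ge0 // subr_ge0.
have F0 : 0 <= (1 - q) ^+ m by rewrite exprn_ge0 // subr_ge0.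
have AD : A x y * D x y <= D x y by rewrite ler_piMl.
rewrite !mulr1 /low_codeg.
apply: (@le_trans _ _ ((q - D x y) * (1 - D x y) ^+ m + (1 - q) ^+ m)); last first.
  by rewrite lerD2r -[leRHS]mulNr ler_wpM2r // opprB lerB.
(* Below [q / 2] the first summand alone is at least [q / 2 * rho ^+ m]; between [q / 2] and [q] it
   is nonnegative; above [q] it is at least [- (1 - q) ^+ m], compensated by the second summand. *)
have [Dlow|Dhigh] := ltrP (D x y) (q / 2).
  rewrite mulr1 -[leLHS]addr0 lerD // ler_pM ?exprn_ge0 ?divr_ge0 ?(ltW q_gt0) //; first lra.
  by rewrite lerXn2r ?nnegrE ?subr_ge0 //; lra.
rewrite mulr0; have [Dq|Dq] := lerP (D x y) q.
  by rewrite addr_ge0 // mulr_ge0 // subr_ge0.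
have EF : (1 - D x y) ^+ m <= (1 - q) ^+ m.
  by rewrite lerXn2r ?nnegrE ?subr_ge0 //; lra.
by nra.
Qed.

(* q / D is approximated by q * sum_(k < m) (1 - D)^k, a polynomial in D. *)
Lemma cut_small_recip c m : cut_small c (fun x y => A x y * D x y - q) ->
  cut_small (2 ^+ m * c + (3 * rho ^+ m + (m%:R + 3) * (\avg_ x \avg_ y low_codeg A x y)))
    (fun x y => A x y - recip_codeg A x y).
Proof.
move=> hM.
have c0 : 0 <= c.
  have h0 : forall x : T, `|(fun=> 0 : R) x| <= 1 by move=> x; rewrite normr0.
  exact: le_trans (normr_ge0 _) (hM _ _ h0 h0).
pose P x y := \sum_(k < m) (1 - D x y) ^+ k.
(* Since [D * P = 1 - (1 - D) ^+ m], the difference [A - recip_codeg A] is [(A * D - q) * P + N].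
   The first term is small in cut norm, the second in L1. *)
pose N x y := A x y * (1 - D x y) ^+ m + (q * P x y - recip_codeg A x y).
have hP : cut_small (2 ^+ m * c) (fun x y => (A x y * D x y - q) * P x y).
  apply: (@cut_small_le _ _ (\sum_(k < m) (2 ^+ k * c))).
    rewrite -mulr_suml ler_wpM2r //.
    have := subrX1 (2 : R) m; rewrite (_ : 2 - 1 = 1) ?mul1r; last by ring.
    by move <-; rewrite lerBlDr lerDl.
  apply: eq_cut_small (cut_small_sum T_gt0 m (fun k => cut_small_mul_expr T_gt0 k A01 hM)).
  by move=> x y; rewrite mulr_sumr.
have PE x y : D x y * P x y = 1 - (1 - D x y) ^+ m.
  have := subrX1 (1 - D x y) m; rewrite -/(P x y) => h.
  by rewrite -[RHS]opprB h; ring.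
have hN : \avg_ x \avg_ y `|N x y| <=
    3 * rho ^+ m + (m%:R + 3) * (\avg_ x \avg_ y low_codeg A x y).
  rewrite -avgZ -[3 * _](avg_cst T_gt0) -avgD; apply: ler_avg => x.
  rewrite -avgZ -[3 * _](avg_cst T_gt0) -avgD; apply: ler_avg => y.
  have [q0 q1] := (q_gt0, q_le1).
  have /andP[D0 D1] := D01 x y; have /andP[A0 A1] := A01 x y.
  have E0 : 0 <= (1 - D x y) ^+ m by rewrite exprn_ge0 // subr_ge0.
  have r0 : 0 <= rho ^+ m by rewrite exprn_ge0.
  rewrite /N /low_codeg /recip_codeg.
  apply: le_trans (ler_normD _ _) _; rewrite normrM (ger0_norm A0) (ger0_norm E0).
  (* For low codegree the truncated reciprocal is 2 and [q * P <= m], which gives [1 + (m + 2)].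
     Otherwise the geometric tails give [rho ^+ m + 2 * rho ^+ m]. *)
  have [Dlow|Dhigh] := ltrP (D x y) (q / 2).
    have E1 : (1 - D x y) ^+ m <= 1 by rewrite exprn_ile1 ?subr_ge0 // lerBlDr lerDl.
    have AE : A x y * (1 - D x y) ^+ m <= 1 by rewrite -[leRHS]mulr1 ler_pM.
    rewrite mulr1; have -> : q / (q / 2) = 2 by field; rewrite lt0r_neq0.
    have P0 : 0 <= P x y by apply: sumr_ge0 => k _; rewrite exprn_ge0 ?subr_ge0.
    have Pm : P x y <= m%:R.
      rewrite -[m in leRHS]card_ord -sumr_const; apply: ler_sum => k _.
      by rewrite exprn_ile1 ?subr_ge0 // lerBlDr lerDl.
    have qP : q * P x y <= m%:R by rewrite -[leRHS]mul1r ler_pM // ltW.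
    have qP0 : 0 <= q * P x y by rewrite mulr_ge0 // ltW.
    have : `|q * P x y - 2| <= m%:R + 2 by rewrite ler_norml; apply/andP; split; lra.
    lra.
  rewrite mulr0 addr0.
  have Dp : 0 < D x y by move: q_gt0; lra.
  have Er : (1 - D x y) ^+ m <= rho ^+ m.
    by rewrite lerXn2r ?nnegrE ?subr_ge0 //; lra.
  have AE : A x y * (1 - D x y) ^+ m <= rho ^+ m by rewrite -[leRHS]mul1r ler_pM.
  have -> : q * P x y - q / D x y = - (q / D x y * (1 - D x y) ^+ m).
    have -> : P x y = (1 - (1 - D x y) ^+ m) / D x y.
      by rewrite -PE mulrC mulKf // lt0r_neq0.
    by field; rewrite lt0r_neq0.
  have qD : q / D x y <= 2 by rewrite ler_pdivrMr //; lra.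
  have qD0 : 0 <= q / D x y by rewrite divr_ge0 // ltW.
  rewrite normrN (ger0_norm (mulr_ge0 qD0 E0)).
  have : q / D x y * (1 - D x y) ^+ m <= 2 * rho ^+ m by rewrite ler_pM.
  lra.
apply: eq_cut_small (cut_smallD hP (cut_small_le hN (@cut_small_abs _ _ N))) => x y.
by rewrite /N mulrBl -mulrA PE; ring.
Qed.

(** With [U = recip_codeg A] and [H] the truncated codegree, [U * H = q], so the defect is the mean
    of [U * |codeg U - H|]. Here [codeg U] is close to [D] by [avg_abs_codegB], and [D] differs from
    [H] only where the codegree is low. *)
Lemma defect_recip_codeg c : cut_small c (fun x y => A x y - recip_codeg A x y) ->
  defect q (recip_codeg A) <= 6 * c + 2 * (\avg_ x \avg_ y low_codeg A x y).
Proof.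
move=> hU; pose U := recip_codeg A; have [_ Ub] := bounded_recip_codeg.
have U02 x y : 0 <= U x y <= 2.
  by have /andP[Uq ->] := Ub x y; rewrite (le_trans (ltW q_gt0) Uq).
have := avg_abs_codegB T_gt0 A01 U02 hU.
set E := \avg_ x _ => hE.
apply: (@le_trans _ _ (2 * E + 2 * (\avg_ x \avg_ y low_codeg A x y))); last first.
  by move: hE; lra.
rewrite -!avgZ -avgD; apply: ler_avg => x; rewrite -!avgZ -avgD; apply: ler_avg => y.
have /andP[U0 U2] := U02 x y; have /andP[D0 D1] := D01 x y.
pose H := Num.max (D x y) (q / 2).
have H0 : 0 < H by rewrite lt_max [0 < q / 2]divr_gt0 ?orbT.
have -> : recip_codeg A x y * codeg (recip_codeg A) x y - q = U x y * (codeg U x y - H).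
  by rewrite mulrBr {2}/U /recip_codeg divfK // lt0r_neq0.
rewrite normrM (ger0_norm U0) -mulrDr ler_pM //.
have -> : codeg U x y - H = - (D x y - codeg U x y) + (D x y - H) by ring.
apply: le_trans (ler_normD _ _) _; rewrite normrN lerD2l /low_codeg /H.
have [Dlow|Dhigh] := ltrP (D x y) (q / 2); last by rewrite subrr normr0.
by have [q0 q1] := (q_gt0, q_le1); rewrite mulr1n ler_norml; apply/andP; split; lra.
Qed.

End Kernel.

Lemma cut_small_recip_codeg eps : 0 < eps -> exists2 c : R, 0 < c &
  forall (T : finType) (A : T -> T -> R), (0 < #|T|)%N -> (forall x y, 0 <= A x y <= 1) ->
  cut_small c (fun x y => A x y * codeg A x y - q) ->
  cut_small eps (fun x y => A x y - recip_codeg A x y) /\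
  \avg_ x \avg_ y low_codeg A x y <= eps.
Proof.
move=> eps0; pose rho := 1 - q / 2.
have rho0 : 0 < rho by rewrite /rho; move: q_gt0 q_le1; lra.
(* As [1 - q < rho], some [m] makes [(1 - q) ^+ m] at most [e * (q / 4) * rho ^+ m]; then [c] gives
   [2 ^+ m * c] the same bound, and [avg_low_codeg_le] is divided by [q / 2 * rho ^+ m]. *)
have low e : 0 < e -> exists2 c : R, 0 < c &
    forall (T : finType) (A : T -> T -> R), (0 < #|T|)%N -> (forall x y, 0 <= A x y <= 1) ->
    cut_small c (fun x y => A x y * codeg A x y - q) ->
    \avg_ x \avg_ y low_codeg A x y <= e.
  move=> e0; have e1 : 0 < e * (q / 4) by rewrite mulr_gt0 // divr_gt0.
  have [|m hm] := @exprn_small R ((1 - q) / rho) _ _ e1.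
    apply/andP; split; first by apply: divr_ge0 (ltW rho0); rewrite subr_ge0.
    by rewrite ltr_pdivrMr // /rho; move: q_gt0; lra.
  have rm : 0 < rho ^+ m by rewrite exprn_gt0.
  have m2 : 0 < 2 ^+ m :> R by rewrite exprn_gt0.
  exists (e * (q / 4) * rho ^+ m / 2 ^+ m); first by rewrite divr_gt0 // mulr_gt0.
  move=> T A T0 A01 hM; have := avg_low_codeg_le T0 A01 m hM.
  rewrite [2 ^+ m * _]mulrC divfK ?lt0r_neq0 // -/rho => h.
  move: hm; rewrite expr_div_n ler_pdivrMr // => hm.
  have k0 : 0 < q / 2 * rho ^+ m by rewrite mulr_gt0 // divr_gt0.
  by rewrite -(ler_pM2l k0); apply: le_trans h _; move: hm; lra.
have e1 : 0 < eps / 9 by rewrite divr_gt0.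
(* This second [m] is the degree of the polynomial approximation. It is fixed before [c], because
   the low-codegree term carries the weight [m + 3]; each of the three terms gets [eps / 3]. *)
have [|m hm] := @exprn_small R rho _ _ e1.
  by rewrite (ltW rho0) /= /rho; move: q_gt0; lra.
have m3 : 1 <= m%:R + 3 :> R by have := ler0n R m; lra.
have m30 : 0 < 3 * (m%:R + 3) :> R by lra.
have [c c0 hc] := low (eps / (3 * (m%:R + 3))) (divr_gt0 eps0 m30).
have m2 : 0 < 2 ^+ m :> R by rewrite exprn_gt0.
have d0 : 0 < eps / 3 / 2 ^+ m by rewrite divr_gt0 // divr_gt0.
exists (Num.min c (eps / 3 / 2 ^+ m)); first by rewrite lt_min c0.
move=> T A T0 A01 hM.
have minl : Num.min c (eps / 3 / 2 ^+ m) <= c by rewrite ge_min lexx.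
have minr : Num.min c (eps / 3 / 2 ^+ m) <= eps / 3 / 2 ^+ m by rewrite ge_min lexx orbT.
have hM1 := cut_small_le minl hM; have hM2 := cut_small_le minr hM.
have := hc T A T0 A01 hM1; rewrite ler_pdivlMr // => hlow.
have L0 : 0 <= \avg_ x \avg_ y low_codeg A x y.
  by apply: avg_ge0 => x; apply: avg_ge0 => y; rewrite ler0n.
split; last by nra.
apply: cut_small_le (cut_small_recip T0 A01 m hM2).
by rewrite [2 ^+ m * _]mulrC divfK ?lt0r_neq0 // -/rho; lra.
Qed.

End Reciprocal.

(** * Cut-norm closeness of A to the constant p *)

Lemma cut_small_of_codeg (R : archiRealFieldType) (p eps : R) : 0 < p <= 1 -> 0 < eps ->
  exists2 c : R, 0 < c & forall (T : finType) (A : T -> T -> R),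
    (0 < #|T|)%N -> (forall x y, 0 <= A x y <= 1) ->
    cut_small c (fun x y => A x y * codeg A x y - p ^+ 3) ->
    cut_small eps (fun x y => A x y - p).
Proof.
case/andP=> p0 p1 eps0; pose q := p ^+ 3.
have q0 : 0 < q by rewrite exprn_gt0.
have q1 : q <= 1 by rewrite exprn_ile1 // ltW.
have q01 : 0 < q <= 1 by rewrite q0.
have q2 : q <= 2 by lra.
have q8 : q <= 2 ^+ 3 by apply: le_trans q1 _; rewrite exprn_ege1 //; lra.
have eps2 : 0 < eps / 2 by rewrite divr_gt0.
(* The stability result is used with [a = q] and [b = 2], the bounds on [recip_codeg]. The
   [delta / 8] in the next line matches the [6 + 2] of [defect_recip_codeg]. *)
have [delta delta0 hdelta] := stable_equation q0 q2 q0 q8 p0 erefl eps2.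
have e0 : 0 < Num.min (eps / 2) (delta / 8) by rewrite lt_min !divr_gt0.
have [c c0 hc] := cut_small_recip_codeg q01 e0.
exists c => // T A T0 A01 hM; have [hU hlow] := hc T A T0 A01 hM.
have le1 : Num.min (eps / 2) (delta / 8) <= eps / 2 by rewrite ge_min lexx.
have le2 : Num.min (eps / 2) (delta / 8) <= delta / 8 by rewrite ge_min lexx orbT.
have hW := hdelta T _ T0 (bounded_recip_codeg q01 T0 A01).
have hd : defect q (recip_codeg q A) <= delta.
  by have := defect_recip_codeg q01 T0 A01 hU; lra.
have := cut_smallD (cut_small_le le1 hU) (cut_small_le (hW hd) (@cut_small_abs _ _ _)).
rewrite -splitr; apply: eq_cut_small => x y; ring.
Qed.

(** * Homomorphism counts *)

Section HomCount.
Variable G : sgraph.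
Local Open Scope nat_scope.

Lemma sum_ffun3 (T : finType) (P : T -> T -> T -> nat) :
  \sum_(f : {ffun 'I_3 -> T}) P (f (inord 0)) (f (inord 1)) (f (inord 2)) =
  \sum_x \sum_y \sum_z P x y z.
Proof.
pose mk (u : T * T * T) : {ffun 'I_3 -> T} :=
  [ffun i : 'I_3 => nth u.2 [:: u.1.1; u.1.2; u.2] i].
rewrite (reindex mk) /=; last first.
  exists (fun f : {ffun 'I_3 -> T} => (f (inord 0), f (inord 1), f (inord 2))).
    by case=> -[x y] z _; rewrite !ffunE !inordK.
  move=> f _; apply/ffunP => -[[|[|[|i]]] hi] //; rewrite ffunE /=;
    by congr (f _); apply: val_inj; rewrite /= inordK.
under eq_bigr => u _ do rewrite !ffunE !inordK //=.
rewrite (pair_big predT predT (fun x y => \sum_z P x y z)) /=.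
by rewrite (pair_big predT predT (fun u z => P u.1 u.2 z)) /=.
Qed.

Lemma sum_ffun4 (T : finType) (P : T -> T -> T -> T -> nat) :
  \sum_(f : {ffun 'I_4 -> T}) P (f (inord 0)) (f (inord 1)) (f (inord 2)) (f (inord 3)) =
  \sum_x \sum_y \sum_z \sum_w P x y z w.
Proof.
pose mk (u : T * T * T * T) : {ffun 'I_4 -> T} :=
  [ffun i : 'I_4 => nth u.2 [:: u.1.1.1; u.1.1.2; u.1.2; u.2] i].
rewrite (reindex mk) /=; last first.
  exists (fun f : {ffun 'I_4 -> T} => (f (inord 0), f (inord 1), f (inord 2), f (inord 3))).
    by case=> -[[x y] z] w _; rewrite !ffunE !inordK.
  move=> f _; apply/ffunP => -[[|[|[|[|i]]]] hi] //; rewrite ffunE /=;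
    by congr (f _); apply: val_inj; rewrite /= inordK.
under eq_bigr => u _ do rewrite !ffunE !inordK //=.
rewrite (pair_big predT predT (fun x y => \sum_z \sum_w P x y z w)) /=.
rewrite (pair_big predT predT (fun u z => \sum_w P u.1 u.2 z w)) /=.
by rewrite (pair_big predT predT (fun u w => P u.1.1 u.1.2 u.2 w)) /=.
Qed.

Lemma hom_K3 : Defs.hom K3 G =
  \sum_(x : G) \sum_(y : G) adj x y * \sum_(z : G) adj x z * adj y z.
Proof.
pose P (x y z : G) : nat := adj x y * (adj x z * adj y z).
transitivity (\sum_(f : {ffun 'I_3 -> G})
    P (f (inord 0)) (f (inord 1)) (f (inord 2))); last first.
  rewrite (sum_ffun3 P); apply: eq_bigr => x _; apply: eq_bigr => y _.
  by rewrite big_distrr.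
rewrite /Defs.hom -sum1_card big_mkcond /=; apply: eq_bigr => f _.
rewrite inE /P !mulnb; set lhs := [forall x, _]; set rhs := _ && _.
suff -> : lhs = rhs by case: rhs.
apply/idP/idP => [/forallP h|/and3P[a01 a02 a12]].
  have e i j : i != j -> adj (f i) (f j) by move=> ij; apply: (implyP (forallP (h i) j)).
  by rewrite /rhs !e // -val_eqE /= !inordK.
apply/forallP => i; apply/forallP => j; apply/implyP => ij.
rewrite -(inord_val i) -(inord_val j); move: ij.
by case: i j => [[|[|[|i]]] hi] [[|[|[|j]]] hj] //= _; rewrite // adj_sym.
Qed.

(** Turns homomorphism constraints into a product, over which sums distribute. *)
Lemma nat_of_forall (I : finType) (P : pred I) :
  nat_of_bool [forall i, P i] = \prod_i nat_of_bool (P i).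
Proof.
have H := big_morph nat_of_bool (fun a b => esym (mulnb a b)) (erefl (nat_of_bool true)).
rewrite -H big_andE.
by congr nat_of_bool; apply: eq_forallb.
Qed.

Fact C4_edge_subproof (i : 'I_4) : [set i; ordS i] \in edges C4.
Proof. by apply/edgesP; exists i, (ordS i); split=> //; rewrite /= /C4_adj eqxx. Qed.

Definition C4_edge (i : 'I_4) : {e : {set C4} | e \in edges C4} :=
  exist (fun e : {set C4} => e \in edges C4) _ (C4_edge_subproof i).

Lemma C4_edge_bij : bijective C4_edge.
Proof.
apply: inj_card_bij; last by rewrite card_sig card_edges_C4 card_ord.
move=> i j [/setP h]; have := h i; have := h (ordS i).
rewrite !inE !eqxx ?orbT /= => a b; move: a b; clear.
by case: i j => [[|[|[|[|]]]] //= ?] [[|[|[|[|]]]] //= ?] // _ _; apply: val_inj.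
Qed.

(** A map splits into its values [h] on the old vertices and [k] on the new ones. For fixed [h] the
    values of [k] are constrained independently, each edge contributing the codegree of the images
    of its ends. *)
Lemma hom_triangulate_C4 (b := fun x y : G => adj x y * \sum_(z : G) adj x z * adj y z) :
  Defs.hom (triangulate C4) G =
  \sum_x \sum_y \sum_z \sum_w b x y * b y z * b z w * b w x.
Proof.
pose E : finType := {e : {set C4} | e \in edges C4}.
pose mk (u : {ffun 'I_4 -> G} * {ffun E -> G}) : {ffun triangulate C4 -> G} :=
  [ffun v : tri_vertex C4 => match v with inl i => u.1 i | inr e => u.2 e end].
pose att (h : {ffun 'I_4 -> G}) (e : E) (z : G) : bool :=
  [forall x : 'I_4, (x \in val e) ==> adj (h x) z].
have hom_mk u : nat_of_bool (mk u \in hom_set (triangulate C4) G) =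
    (\prod_(i < 4) adj (u.1 i) (u.1 (ordS i))) * \prod_e att u.1 e (u.2 e).
  rewrite -!nat_of_forall mulnb inE; congr nat_of_bool; apply/idP/idP.
    move=> /forallP h; have e v w : adj v w -> adj (mk u v) (mk u w).
      by move=> vw; apply: (implyP (forallP (h v) w)).
    apply/andP; split.
      apply/forallP => i; have := e (inl i) (inl (ordS i)); rewrite !ffunE; apply.
      by rewrite /= /C4_adj eqxx.
    apply/forallP => d; apply/forallP => x; apply/implyP => xd.
    by have := e (inl x) (inr d); rewrite !ffunE; apply.
  case/andP=> /forallP hC /forallP hE.
  have hE' x (d : E) : x \in val d -> adj (u.1 x) (u.2 d).
    by move=> xd; apply: (implyP (forallP (hE d) x)).
  apply/forallP => v; apply/forallP => w; apply/implyP; rewrite !ffunE.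
  case: v w => [x|d] [y|d'] //=; last by move=> xd; rewrite adj_sym; exact: hE'.
    by case/orP=> /eqP <-; rewrite // adj_sym.
  exact: hE'.
transitivity (\sum_(f : {ffun triangulate C4 -> G}) (f \in hom_set (triangulate C4) G)).
  by rewrite /Defs.hom -sum1_card big_mkcond /=; apply: eq_bigr => f _; case: (f \in _).
rewrite (reindex mk) /=; last first.
  exists (fun f : {ffun tri_vertex C4 -> G} =>
            ([ffun i => f (inl i)], [ffun e => f (inr e)])).
    by case=> h k _; congr (_, _); apply/ffunP => v; rewrite !ffunE.
  by move=> f _; apply/ffunP => -[i|e]; rewrite !ffunE.
under eq_bigr => u _ do rewrite hom_mk.
rewrite -(pair_big predT predT (fun (h : {ffun 'I_4 -> G}) (k : {ffun E -> G}) =>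
  (\prod_(i < 4) adj (h i) (h (ordS i))) * \prod_e att h e (k e))) /=.
pose P x y z w := b x y * b y z * b z w * b w x.
rewrite -(sum_ffun4 P); apply: eq_bigr => h _.
(* The sum over [k] of a product over edges becomes a product of sums, which [C4_edge] then indexes
   by the first vertex of each edge. *)
rewrite -big_distrr /= -(bigA_distr_bigA (fun e z => nat_of_bool (att h e z))) /=.
rewrite (reindex C4_edge) /=; last exact/onW_bij/C4_edge_bij.
rewrite -big_split /=.
have step i : adj (h i) (h (ordS i)) * (\sum_z att h (C4_edge i) z) = b (h i) (h (ordS i)).
  congr (_ * _); apply: eq_bigr => z _; rewrite mulnb; congr nat_of_bool.
  apply/idP/idP => [/forallP ht|/andP[h1 h2]].
    by rewrite (implyP (ht i)) ?(implyP (ht (ordS i))) // !inE eqxx ?orbT.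
  by apply/forallP => x; apply/implyP; rewrite !inE => /orP[] /eqP ->.
under eq_bigr => i _ do rewrite step.
rewrite !big_ord_recl big_ord0 muln1 /P -(mulnA (b _ _ * b _ _)) -(mulnA (b _ _)).
by congr (b _ _ * (b _ _ * (b _ _ * b _ _))); congr (h _); apply: val_inj; rewrite /= ?inordK.
Qed.

End HomCount.

(** * Homomorphism densities as averages *)

Lemma avg2E (R : realFieldType) (T : finType) (F : T -> T -> R) :
  \avg_ x \avg_ y F x y = (\sum_x \sum_y F x y) / #|T|%:R ^+ 2.
Proof. by rewrite /avg -mulr_suml -mulrA -invfM -expr2. Qed.

Section Density.
Variables (R : realType) (G : sgraph).

Definition adjR (x y : G) : R := (adj x y)%:R.

Lemma hom_density_K3 :
  hom_density R K3 G = \avg_ x \avg_ y (adjR x y * codeg adjR x y).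
Proof.
have n0 : #|G|%:R != 0 :> R by rewrite pnatr_eq0 -lt0n vertex_gt0.
pose F (x y : G) : nat := (adj x y * \sum_(z : G) adj x z * adj y z)%N.
have FE x y : adjR x y * codeg adjR x y = (F x y)%:R / #|G|%:R.
  rewrite /codeg /avg natrM natr_sum mulrA; congr (_ * _ / _).
  by apply: eq_bigr => z _; rewrite natrM.
rewrite (@eq_avg _ _ _ (fun x => (\avg_ y (F x y)%:R) / #|G|%:R)); last first.
  by move=> x; rewrite -avgZr; apply: eq_avg.
rewrite avgZr avg2E -mulrA -invfM -exprSr /hom_density hom_K3 card_ord natrX; congr (_ / _).
by rewrite natr_sum; apply: eq_bigr => x _; rewrite natr_sum.
Qed.

(** Of the eight factors [#|G|] in the denominator, four normalise the codegrees and four the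
    averages. *)
Lemma hom_density_triangulate_C4 (B := fun x y => adjR x y * codeg adjR x y) :
  hom_density R (triangulate C4) G =
  \avg_ x \avg_ y \avg_ z \avg_ w (B x y * B y z * B z w * B w x).
Proof.
have n0 : #|G|%:R != 0 :> R by rewrite pnatr_eq0 -lt0n vertex_gt0.
pose b (x y : G) : nat := (adj x y * \sum_(z : G) adj x z * adj y z)%N.
have BE x y : B x y = (b x y)%:R / #|G|%:R.
  rewrite /B /codeg /avg natrM natr_sum mulrA; congr (_ * _ / _).
  by apply: eq_bigr => z _; rewrite natrM.
pose F x y z w : R := (b x y * b y z * b z w * b w x)%:R.
have FE x y z w : B x y * B y z * B z w * B w x = F x y z w / #|G|%:R ^+ 4.
  rewrite /F !BE; move: (b x y) (b y z) (b z w) (b w x) => b1 b2 b3 b4.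
  by rewrite !natrM; field.
have -> : \avg_ x \avg_ y \avg_ z \avg_ w (B x y * B y z * B z w * B w x) =
    (\avg_ x \avg_ y \avg_ z \avg_ w F x y z w) / #|G|%:R ^+ 4.
  do 3![rewrite -avgZr; apply: eq_avg => ?].
  by rewrite -avgZr; apply: eq_avg => w; rewrite FE.
rewrite /hom_density hom_triangulate_C4 card_triangulate_C4 natrX.
have -> : \avg_ x \avg_ y \avg_ z \avg_ w F x y z w =
    (\sum_x \sum_y \sum_z \sum_w F x y z w) / #|G|%:R ^+ 4.
  rewrite (avg2E (fun x y => \avg_ z \avg_ w F x y z w)).
  rewrite (eq_bigr (fun x => (\sum_y \sum_z \sum_w F x y z w) / #|G|%:R ^+ 2)).
    by rewrite -mulr_suml -mulrA -invfM -exprD.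
  by move=> x _; rewrite mulr_suml; apply: eq_bigr => y _; rewrite avg2E.
rewrite -[RHS]mulrA -invfM -exprD; congr (_ / _).
by do 4![rewrite natr_sum; apply: eq_bigr => ? _].
Qed.

End Density.

(** * The forcing property *)

Theorem corollary1p3 (R : realType) : forcing R K3 (triangulate C4).
Proof.
move=> p eps p0 p1 eps0.
have p01 : 0 < p <= 1 by rewrite p0.
have [c c0 hc] := cut_small_of_codeg p01 eps0.
have q0 : 0 < p ^+ 3 by rewrite exprn_gt0.
have q1 : p ^+ 3 <= 1 by rewrite exprn_ile1 // ltW.
pose delta := Num.min 1 (c ^+ 4 / 45).
have delta0 : 0 < delta by rewrite lt_min ltr01 divr_gt0 ?exprn_gt0.
have delta1 : delta <= 1 by rewrite ge_min lexx.
have delta_c : 45 * delta <= c ^+ 4.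
  by rewrite mulrC -ler_pdivlMr // ge_min lexx orbT.
exists delta => // G; rewrite card_edges_K3 card_edges_triangulate_C4.
rewrite hom_density_K3 hom_density_triangulate_C4 => hK hC X Y.
have G0 := vertex_gt0 G; have n0 : 0 < #|G|%:R :> R by rewrite ltr0n.
pose A := @adjR R G.
have A01 x y : 0 <= A x y <= 1 by rewrite /A /adjR; case: (adj x y); rewrite lexx ler01.
have BC x y : A x y * codeg A x y = A y x * codeg A y x.
  rewrite /A /adjR adj_sym; congr (_ * _); apply: eq_avg => z; exact: mulrC.
have hA : cut_small eps (fun x y => A x y - p).
  apply: (hc G A G0 A01).
  (* The hypotheses are the edge and 4-cycle density conditions for the weighted graph A D with
     [q = p ^+ 3], as [p ^+ 12 = q ^+ 4]. *)
  apply: (@cut_small_of_C4 R G (p ^+ 3) delta c (fun x y => A x y * codeg A x y)) => //.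
  - by rewrite q0.
  - by rewrite delta0.
  - by rewrite -exprM.
have ind01 (Z : {set G}) x : `|(x \in Z)%:R| <= 1 :> R by rewrite normr_nat; case: (x \in Z).
(* Indicator functions of [X] and [Y] as test functions recover the edge count over ordered
   pairs. *)
have := hA _ _ (ind01 X) (ind01 Y).
have -> : \avg_ x \avg_ y ((A x y - p) * (x \in X)%:R * (y \in Y)%:R) =
  ((edge_count X Y)%:R - p * #|X|%:R * #|Y|%:R) / #|G|%:R ^+ 2.
  rewrite avg2E; congr (_ / _).
  have cardE (Z : {set G}) : #|Z|%:R = \sum_x (x \in Z)%:R :> R.
    by rewrite -sum1_card big_mkcond natr_sum; apply: eq_bigr => x _; case: (x \in Z).
  have -> : (edge_count X Y)%:R = \sum_x \sum_y A x y * (x \in X)%:R * (y \in Y)%:R.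
    rewrite /edge_count -sum1_card big_mkcond natr_sum.
    rewrite (pair_big predT predT (fun x y => A x y * (x \in X)%:R * (y \in Y)%:R)) /=.
    apply: eq_bigr => -[x y] _; rewrite !inE /= /A /adjR -!natrM !mulnb.
    by rewrite andbC andbA; case: (_ && _).
  rewrite !cardE -mulrA mulr_suml mulr_sumr -sumrB; apply: eq_bigr => x _.
  by rewrite mulr_sumr mulr_sumr -sumrB; apply: eq_bigr => y _; ring.
by rewrite normrM normfV (ger0_norm (exprn_ge0 2 (ltW n0))) ler_pdivrMr // exprn_gt0.
Qed.
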